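(* Let $U\in\operatorname{Gr}^0(V)$ be a rational point with $\Omega_+(U)\neq 0$, where $V=k((z))^{\oplus n}$. Then, for all $N\gg 0$, the inverse image of $\Omega_+$ by the morphism $\bar\mu_U^N:\prod^N\widehat C^n\to\operatorname{Gr}(V)$ is given (up to a non-zero scalar) by $$\Big(\prod_{j=1}^n\Delta_j\Big)^{-1}\cdot\det\begin{pmatrix} f^1_1(t_{11})&\ldots&f^1_1(t_{N1})&\ldots&f^1_n(t_{1n})&\ldots&f^1_n(t_{Nn})\\ \vdots&&&&&&\vdots\\ f^M_1(t_{11})&\ldots&f^M_1(t_{N1})&\ldots&f^M_n(t_{1n})&\ldots&f^M_n(t_{Nn})\end{pmatrix}$$ where $M:=N\cdot n$, $\{f^i=(f^i_1,\ldots,f^i_n)\}_{1\le i\le M}$ is a basis of $V^+\cap z^NU$, and $\Delta_j:=\prod_{1\le i<l\le N}(t_{ij}-t_{lj})$.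
   Context: $k$ is an algebraically closed field of characteristic $0$, $E=k^{\oplus n}$ with basis $e_1,\dots,e_n$, $V=E((z))=k((z))^{\oplus n}$, $V^+=E[[z]]=k[[z]]^{\oplus n}$. $T_1,\dots,T_n\in\operatorname{End}(E)$ are the operators $T_i(e_j)=\delta_{ij}e_i$ (a basis of a commutative semisimple subalgebra of $\operatorname{End}(E)$). Infinite Grassmannian. For subspaces $A,B\subset V$ write $A\sim B$ if $\dim (A+B)/(A\cap B)<\infty$. For a $k$-scheme $S$ and a subspace $A\subseteq V$, put $\widehat A_S=\varprojlim_{B\sim V^+}\big((A/A\cap B)\otimes\mathcal O_S\big)$. $\operatorname{Gr}(V)$ is the $k$-scheme locally covered by the open subschemes $F_A(S)=\{\mathcal O_S\text{-submodules } \mathcal L\subset \widehat V_S \text{ with }\mathcal L\oplus\widehat A_S=\widehat V_S\}$, for $A\sim V^+$. Rational points are certain $k$-subspaces $U\subset V$; the connected component $\operatorname{Gr}^0(V)$ consists of those of index $\dim(U\cap V^+)-\dim(V/(U+V^+))=0$. On $\operatorname{Gr}^0(V)$ the bundle $\operatorname{Det}$ is the determinant of the perfect complex $\mathcal L\oplus\widehat V^+\to\widehat V$ (addition map, $\mathcal L$ the universal submodule), equivalently of $\mathcal L\to V/V^+$; this map induces canonically the global section $\Omega_+$ of $\operatorname{Det}^*$. The morphism. $\widehat C^n=\operatorname{Spf}k[[t_1,\dots,t_n]]$ and $\prod^N\widehat C^n$ is the formal spectrum of $k[[\{t_{ij}\}_{1\le i\le N,\,1\le j\le n}]]$. The morphism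 $\bar\mu_U^N:\prod^N\widehat C^n\to\operatorname{Gr}(V)$ is given by $$\Big(\prod_{1\le i\le N,\ 1\le j\le n}\big(1-T_j\tfrac{t_{ij}}{z}\big)\Big)^{-1}(U),$$ i.e. the $j$-th component of the elements of $U$ is multiplied by $\prod_{i=1}^N(1-t_{ij}/z)^{-1}$. The pullback of $\operatorname{Det}^*$ is trivial: the morphism factors through the orbit map $\mu_U:\Gamma_-^n\to\operatorname{Gr}(V)$ of the formal group $\Gamma^n_-$ of $n$-tuples of series $1+\sum_{i>0}a_{ij}z^{-i}$ ($a_{ij}$ nilpotent, componentwise multiplication), whose action on $\operatorname{Gr}(V)$ by componentwise multiplication preserves $\operatorname{Det}$, and the group structure of $\Gamma_-^n$ gives a trivialization of $\mu_U^*\operatorname{Det}^*$. With this trivialization the inverse image of $\Omega_+$ is regarded as an element of $k[[\{t_{ij}\}]]$. *)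

(* Defs.v *)
From HB Require Import structures.
From mathcomp Require Import all_boot all_order all_algebra.
From mathcomp Require Import mpoly.
From mathcomp Require Import boolp classical_sets.

Set Implicit Arguments.
Unset Strict Implicit.
Unset Printing Implicit Defensive.

Import Order.TTheory GRing.Theory Num.Theory.
Local Open Scope classical_set_scope.
Local Open Scope ring_scope.

(* k[[X_0, ..., X_(p-1)]]: arbitrary families of coefficients indexed by
   monomials, with the product of multinomials' [mcoeffM]. *)
Section MultivariatePowerSeries.
Variables (p : nat) (R : comNzRingType).

Record mps := MPS { mps_coef :> 'X_{1..p} -> R }.

HB.instance Definition _ := [isNew for mps_coef].
HB.instance Definition _ := [Choice of mps by <:].

Implicit Types f g h : mps.

Lemma mpsP f g : (forall m, f m = g m) -> f = g.
Proof. by case: f => f; case: g => g /= fg; congr MPS; apply/funext. Qed.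

Definition mps_zero := MPS (fun=> 0).
Definition mps_opp f := MPS (fun m => - f m).
Definition mps_add f g := MPS (fun m => f m + g m).
Definition mps_scale (a : R) f := MPS (fun m => a * f m).
Definition mps_one := MPS (fun m => (m == 0%MM)%:R).
Definition mps_mul f g := MPS (fun m =>
  \sum_(k : 'X_{1..p < (mdeg m).+1, (mdeg m).+1} | m == (k.1 + k.2)%MM)
    f k.1 * g k.2).

Fact mps_addA : associative mps_add.
Proof. by move=> f g h; apply/mpsP => m /=; rewrite addrA. Qed.
Fact mps_addC : commutative mps_add.
Proof. by move=> f g; apply/mpsP => m /=; rewrite addrC. Qed.
Fact mps_add0 : left_id mps_zero mps_add.
Proof. by move=> f; apply/mpsP => m /=; rewrite add0r. Qed.
Fact mps_addN : left_inverse mps_zero mps_opp mps_add.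
Proof. by move=> f; apply/mpsP => m /=; rewrite addNr. Qed.

HB.instance Definition _ :=
  GRing.isZmodule.Build mps mps_addA mps_addC mps_add0 mps_addN.

Let trunc b f : {mpoly R[p]} := \sum_(m : 'X_{1..p < b}) f m *: 'X_[m].

Let trunc_coef b f m : (mdeg m < b)%N -> (trunc b f)@_m = f m.
Proof. exact: mcoeff_mpoly. Qed.

Let coefM b f g m : (mdeg m < b)%N ->
  mps_mul f g m = (trunc b f * trunc b g)@_m.
Proof.
move=> mb; rewrite mcoeffM /=; apply: eq_bigr => -[k1 k2] /= _.
by rewrite !trunc_coef //; apply: leq_trans mb; apply: bmdeg.
Qed.

Let eq_coefM (P Q P' Q' : {mpoly R[p]}) m :
  (forall k, (mdeg k <= mdeg m)%N -> P@_k = P'@_k /\ Q@_k = Q'@_k) ->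
  (P * Q)@_m = (P' * Q')@_m.
Proof.
move=> PQ; rewrite !mcoeffM; apply: eq_bigr => -[k1 k2] /= _.
by rewrite (PQ k1 _).1 ?(PQ k2 _).2 // -ltnS bmdeg.
Qed.

Fact mps_mulA : associative mps_mul.
Proof.
move=> f g h; apply/mpsP => m; rewrite !(coefM _ _ (ltnSn _)).
set b := (mdeg m).+1; transitivity (trunc b f * (trunc b g * trunc b h))@_m.
  apply: eq_coefM => i im; split=> //; rewrite -(coefM _ _ (b := b)) //.
  exact: trunc_coef.
rewrite mulrA; apply: eq_coefM => i im; split=> //.
by rewrite -(coefM _ _ (b := b)) // trunc_coef.
Qed.

Fact mps_mulC : commutative mps_mul.
Proof.
by move=> f g; apply/mpsP => m; rewrite !(coefM _ _ (ltnSn _)) mulrC.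
Qed.

Fact mps_mul1 : left_id mps_one mps_mul.
Proof.
move=> f; apply/mpsP => m; rewrite (coefM _ _ (ltnSn _)).
transitivity (1 * trunc (mdeg m).+1 f)@_m; last by rewrite mul1r trunc_coef.
by apply: eq_coefM => k km; rewrite trunc_coef ?ltnS //= mcoeff1.
Qed.

Fact mps_mulDl : left_distributive mps_mul mps_add.
Proof.
move=> f g h; apply/mpsP => m /=; rewrite -big_split /=.
by apply: eq_bigr => k _; rewrite mulrDl.
Qed.

Fact mps_oner_neq0 : mps_one != 0.
Proof.
by apply/eqP => /(congr1 (mps_coef ^~ 0%MM))/eqP; rewrite /= eqxx oner_eq0.
Qed.

HB.instance Definition _ := GRing.Zmodule_isComNzRing.Build mps
  mps_mulA mps_mulC mps_mul1 mps_mulDl mps_oner_neq0.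

Fact mps_scaleA a b f : mps_scale a (mps_scale b f) = mps_scale (a * b) f.
Proof. by apply/mpsP => m /=; rewrite mulrA. Qed.
Fact mps_scale1 : left_id 1 mps_scale.
Proof. by move=> f; apply/mpsP => m /=; rewrite mul1r. Qed.
Fact mps_scaleDr : right_distributive mps_scale +%R.
Proof. by move=> a f g; apply/mpsP => m /=; rewrite mulrDr. Qed.
Fact mps_scaleDl f : {morph mps_scale^~ f : a b / a + b}.
Proof. by move=> a b; apply/mpsP => m /=; rewrite mulrDl. Qed.

HB.instance Definition _ := GRing.Zmodule_isLmodule.Build R mps
  mps_scaleA mps_scale1 mps_scaleDr mps_scaleDl.

Definition mps_var (i : 'I_p) : mps := MPS (fun m => (m == U_(i)%MM)%:R).

End MultivariatePowerSeries.

(* Spf k[[X_0, ..., X_(p-1)]] is the union of the Spec k[X]/(X)^b, so its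
   points with values in a k-algebra R are the tuples t killed by all monomials
   of degree >= b for some b; at such a t a power series is a finite sum. *)
Definition formal_point (p : nat) (k : comNzRingType) (R : comAlgType k)
    (b : nat) (t : 'I_p -> R) : Prop :=
  forall m : 'X_{1..p}, (b <= mdeg m)%N -> mmap1 t m = 0.

Definition mps_eval (p : nat) (k : comNzRingType) (R : comAlgType k)
    (b : nat) (t : 'I_p -> R) (f : mps p k) : R :=
  \sum_(m : 'X_{1..p < b}) f m *: mmap1 t m.

(* R((z)); [x i] is the coefficient of z^i. *)
Section Laurent.
Variable R : comNzRingType.

Record laurent := Laurent {
  lcoef :> int -> R;
  lcoefP : exists m : int, forall i, i < m -> lcoef i = 0 }.

HB.instance Definition _ := gen_eqMixin laurent.
HB.instance Definition _ := gen_choiceMixin laurent.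

Implicit Types x y : laurent.

Lemma laurentext x y : (forall i, x i = y i) -> x = y.
Proof.
case: x => x xP; case: y => y yP /= /funext xy; subst y.
by congr Laurent; apply: Prop_irrelevance.
Qed.

Fact laurent_zeroP : exists m : int, forall i, i < m -> 0 = 0 :> R.
Proof. by exists 0. Qed.
Fact laurent_oppP x : exists m : int, forall i, i < m -> - x i = 0.
Proof. by have [m xm] := lcoefP x; exists m => i /xm ->; rewrite oppr0. Qed.
Fact laurent_addP x y : exists m : int, forall i, i < m -> x i + y i = 0.
Proof.
have [m xm] := lcoefP x; have [m' ym] := lcoefP y; exists (Order.min m m') => i.
by rewrite lt_min => /andP[/xm -> /ym ->]; rewrite addr0.
Qed.
Fact laurent_scaleP a x : exists m : int, forall i, i < m -> a * x i = 0.
Proof. by have [m xm] := lcoefP x; exists m => i /xm ->; rewrite mulr0. Qed.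

Definition laurent_zero := Laurent laurent_zeroP.
Definition laurent_opp x := Laurent (laurent_oppP x).
Definition laurent_add x y := Laurent (laurent_addP x y).
Definition laurent_scale a x := Laurent (laurent_scaleP a x).

Fact laurent_addA : associative laurent_add.
Proof. by move=> x y z; apply/laurentext => i /=; rewrite addrA. Qed.
Fact laurent_addC : commutative laurent_add.
Proof. by move=> x y; apply/laurentext => i /=; rewrite addrC. Qed.
Fact laurent_add0 : left_id laurent_zero laurent_add.
Proof. by move=> x; apply/laurentext => i /=; rewrite add0r. Qed.
Fact laurent_addN : left_inverse laurent_zero laurent_opp laurent_add.
Proof. by move=> x; apply/laurentext => i /=; rewrite addNr. Qed.

HB.instance Definition _ := GRing.isZmodule.Build laurent
  laurent_addA laurent_addC laurent_add0 laurent_addN.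

Fact laurent_scaleA a b x :
  laurent_scale a (laurent_scale b x) = laurent_scale (a * b) x.
Proof. by apply/laurentext => i /=; rewrite mulrA. Qed.
Fact laurent_scale1 : left_id 1 laurent_scale.
Proof. by move=> x; apply/laurentext => i /=; rewrite mul1r. Qed.
Fact laurent_scaleDr : right_distributive laurent_scale +%R.
Proof. by move=> a x y; apply/laurentext => i /=; rewrite mulrDr. Qed.
Fact laurent_scaleDl x : {morph laurent_scale^~ x : a b / a + b}.
Proof. by move=> a b; apply/laurentext => i /=; rewrite mulrDl. Qed.

HB.instance Definition _ := GRing.Zmodule_isLmodule.Build R laurent
  laurent_scaleA laurent_scale1 laurent_scaleDr laurent_scaleDl.

Fact laurent_mulP (q : {poly R}) x : exists m : int,
  forall i, i < m -> \sum_(s < size q) q`_s * x (i + s%:Z) = 0.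
Proof.
have [m xm] := lcoefP x; exists (m - (size q)%:Z) => i im.
apply: big1 => s _; rewrite xm ?mulr0 //.
rewrite ltrBrDr in im; apply: le_lt_trans im.
by rewrite lerD2l lez_nat ltnW.
Qed.

(* The product q(z^-1) x. *)
Definition laurent_mul (q : {poly R}) x : laurent := Laurent (laurent_mulP q x).

Fact laurent_of_negP (q : {poly R}) : exists m : int, forall i, i < m ->
  (if i is Negz s then q`_s else 0) = 0.
Proof.
exists (- (size q)%:Z) => -[//|s]; rewrite NegzE ltrN2 ltz_nat ltnS => qs.
by rewrite nth_default.
Qed.

(* z^-1 q(z^-1); note that [Negz s] is -(s + 1). *)
Definition laurent_of_neg (q : {poly R}) : laurent :=
  Laurent (laurent_of_negP q).

End Laurent.

Fact laurent_mapP (k : comNzRingType) (R : comAlgType k) (x : laurent k) :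
  exists m : int, forall i, i < m -> (x i)%:A = 0 :> R.
Proof. by have [m xm] := lcoefP x; exists m => i /xm ->; rewrite scale0r. Qed.

Definition laurent_map (k : comNzRingType) (R : comAlgType k) (x : laurent k) :
  laurent R := Laurent (laurent_mapP R x).

(* x(X_i) for x in k[[z]]; only coefficients of nonnegative index are used. *)
Definition laurent_subst (p : nat) (k : comNzRingType) (i : 'I_p)
    (x : laurent k) : mps p k :=
  MPS (fun m => if m == (U_(i) *+ m i)%MM then x (m i)%:Z else 0).

(* For an affine S = Spec R, the sections over S of the completion of V are
   R((z))^n: the inverse limit over m of R (x) (V / z^m V^+). *)
Notation Vhat R n := {ffun 'I_n -> laurent R}.

(* V^- = z^-1 R[z^-1]^n, a tuple q of polynomials standing for
   z^-1 q(z^-1). *)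
Notation Vminus R n := {ffun 'I_n -> {poly R}}.

Section Grassmannian.
Variables (R : comNzRingType) (n : nat).
Implicit Types (x : Vhat R n) (A B L : set (Vhat R n)).

Definition iota (q : Vminus R n) : Vhat R n :=
  [ffun j => laurent_of_neg (q j)].

(* z^m V^+ *)
Definition zVplus (m : int) : set (Vhat R n) :=
  [set x : Vhat R n | forall j i, i < m -> x j i = 0].

Definition Vplus := zVplus 0.

(* z^m A *)
Definition zshift (m : int) A : set (Vhat R n) :=
  [set x : Vhat R n | exists2 y, A y & forall j i, x j i = y j (i - m)].

Definition submodule L : Prop := submod_closed [pred x | x \in L].

Definition span (S : set (Vhat R n)) : set (Vhat R n) :=
  [set x : Vhat R n | forall L, submodule L -> S `<=` L -> L x].

Definition set_sum A B : set (Vhat R n) :=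
  [set x : Vhat R n | exists a b, [/\ A a, B b & x = a + b]].

Definition direct_sum_total A B : Prop :=
  set_sum A B = setT /\ A `&` B = [set 0].

(* v induces a basis of A / (A `&` B). *)
Definition basis_mod (d : nat) A B (v : 'I_d -> Vhat R n) : Prop :=
  [/\ forall i, A (v i),
      forall x, A x -> exists c : 'I_d -> R, B (x - \sum_i c i *: v i)
    & forall c : 'I_d -> R, B (\sum_i c i *: v i) -> forall i, c i = 0].

Definition dim_mod A B (d : nat) : Prop :=
  exists v : 'I_d -> Vhat R n, basis_mod A B v.

(* A ~ B *)
Definition commensurable A B : Prop :=
  exists d, dim_mod (set_sum A B) (A `&` B) d.

(* The completion of a subspace A inside the completion of V: the closure of A
   for the z-adic topology. *)
Definition zclosure A : set (Vhat R n) :=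
  [set x : Vhat R n | forall m, exists2 y, A y & zVplus m (x - y)].

End Grassmannian.

Arguments Vplus {R n}.

Definition is_basis (R : comNzRingType) n d A (v : 'I_d -> Vhat R n) : Prop :=
  basis_mod A [set 0] v.

Section RationalPoints.
Variables (k : fieldType) (n : nat).
Implicit Types U A : set (Vhat k n).

(* Rational points of Gr(V): the union of the F_A(Spec k), A ~ V^+. *)
Definition Gr U : Prop :=
  submodule U /\ exists A, [/\ submodule A, commensurable A (Vplus)
                             & direct_sum_total U (zclosure A)].

Definition Gr0 U : Prop :=
  Gr U /\ exists d, dim_mod (U `&` Vplus) [set 0] d
                 /\ dim_mod setT (set_sum U (Vplus)) d.

End RationalPoints.

(* The determinant of the complex L -> V/V^+ at an R-point L of Gr^0(V).
   If L + z^-m V^+ = V, this complex is quasi-isomorphic to the complex of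
   finite free modules
     L /\ z^-m V^+  -->  F_m := z^-m V^+ / V^+ = <e_j z^-i, 1 <= i <= m>
   so Det(L) = det(L /\ z^-m V^+) (x) det(F_m)^-1.  Let w : V^- -> L be an
   isomorphism with w(v) = v mod z^-m V^+ for all v.  It maps the standard
   basis of F_m (seen in V^-) to a basis of L /\ z^-m V^+, hence generates
   Det(L); the values w(e_j z^-i), i > m, are lifts to L of the standard basis
   of (z^-i V^+) / (z^(1-i) V^+) and give the identification of the generators
   obtained from larger values of m.  Such a w is a frame of L.  Two frames
   are related by w' = w o T with T = id modulo F_m, and the corresponding
   generators of Det(L) differ by det T := det (T | F_m).  So an element of
   Det(L)^* is a function of frames multiplied by det T under w |-> w o T. *)
Section Determinant.
Variables (R : comNzRingType) (n : nat).
Implicit Types (w : Vminus R n -> Vhat R n) (s : (Vminus R n -> Vhat R n) -> R).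

Definition congr_id (m : nat) w : Prop :=
  forall v, zVplus (- m%:Z) (w v - iota v).

Definition Fm (m : nat) (u : 'rV[R]_(m * n)) : Vminus R n :=
  [ffun j => \sum_(a < m) u 0 (mxvec_index a j) *: 'X^a].

Definition principal_part (m : nat) (x : Vhat R n) : 'rV[R]_(m * n) :=
  mxvec (\matrix_(a < m, j < n) x j (Negz a)).

(* The determinant of V^- -> V -> V/V^+ = V^-, for a map which is the identity
   modulo z^-m V^+ for some m (it does not depend on m). *)
Definition fdet w : R :=
  let m := xget 0%N [set m | congr_id m w] in
  \det (lin1_mx (fun u => principal_part m (w (Fm u)))).

Definition frame (L : set (Vhat R n)) w : Prop :=
  [/\ linear w, injective w, range w = L & exists m, congr_id m w].

Definition det_dual (L : set (Vhat R n)) s : Prop :=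
  forall w (T : Vminus R n -> Vminus R n), frame L w -> frame L (w \o T) ->
    s (w \o T) = fdet (@iota R n \o T) * s w.

Definition section_eq (L : set (Vhat R n)) s s' : Prop :=
  forall w, frame L w -> s w = s' w.

(* The section of Det^* induced by L -> V/V^+. *)
Definition Omega_plus w : R := fdet w.

End Determinant.

Arguments iota {R n}.
Arguments Omega_plus {R n}.

(* The action of Gamma_-^n on V^- and on V; a series 1 + sum_i a_i z^-i of
   Gamma_-(R) is a polynomial in z^-1. *)
Definition act_minus (R : comNzRingType) n (g v : Vminus R n) : Vminus R n :=
  [ffun j => g j * v j].

Definition act (R : comNzRingType) n (g : Vminus R n) (x : Vhat R n) :
  Vhat R n := [ffun j => laurent_mul (g j) (x j)].

Section Pullback.
Variables (k : fieldType) (n : nat).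
Implicit Types U : set (Vhat k n).

Definition Vmap (R : comAlgType k) (x : Vhat k n) : Vhat R n :=
  [ffun j => laurent_map R (x j)].

(* The R-point of Gr(V) defined by U: the image of U (x) R. *)
Definition scalar_ext (R : comAlgType k) U : set (Vhat R n) :=
  span [set Vmap R x | x in U].
Arguments scalar_ext R U : clear implicits.

Definition Vminus_map (R : comAlgType k) (v : Vminus k n) : Vminus R n :=
  [ffun j => map_poly (in_alg R) (v j)].

(* sR is the image of s under Det(U)^* -> Det(U_R)^* = R (x) Det(U)^*. *)
Definition det_dual_ext (R : comAlgType k) U
    (s : (Vminus k n -> Vhat k n) -> k)
    (sR : (Vminus R n -> Vhat R n) -> R) : Prop :=
  det_dual (scalar_ext R U) sR /\
  forall w wR, frame U w -> linear wR ->
    (forall v, wR (Vminus_map R v) = Vmap R (w v)) -> sR wR = (s w)%:A.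

(* The action of g in Gamma_-^n(R) on Det^*: since g preserves V^-, it maps a
   frame w of L to the frame g w g^-1 of gL, hence Det(L)^* to Det(gL)^*.
   Here h = g^-1. *)
Definition det_dual_act (R : comNzRingType) (g h : Vminus R n)
    (s : (Vminus R n -> Vhat R n) -> R) : (Vminus R n -> Vhat R n) -> R :=
  fun w => s (fun v => act h (w (act_minus g v))).

(* Given a generator delta of Det(U)^*, the trivialization of mu_U^* Det^* is
   the section g |-> g . delta; a is the value at g of the function which
   corresponds to Omega_+. *)
Definition tau_value (R : comAlgType k) U
    (delta : (Vminus k n -> Vhat k n) -> k) (g h : Vminus R n) (a : R) : Prop :=
  exists2 deltaR, det_dual_ext U delta deltaR &
    section_eq [set act g x | x in scalar_ext R U] Omega_plus
      (fun w => a * det_dual_act g h deltaR w).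

(* The index of t_ij; the variables are ordered as the columns of the
   determinant, t_11, ..., t_N1, ..., t_1n, ..., t_Nn. *)
Definition tidx (N : nat) (i : 'I_N) (j : 'I_n) : 'I_(n * N) :=
  mxvec_index j i.

(* The n-tuple with j-th component prod_i (1 - t_ij / z). *)
Definition mu_inv (R : comNzRingType) (N : nat) (t : 'I_(n * N) -> R) :
    Vminus R n :=
  [ffun j => \prod_(i < N) (1 - t (tidx i j) *: 'X)].

(* tau in k[[{t_ij}]] is the inverse image of Omega_+ under the morphism
   \bar mu_U^N, for the trivialization defined by delta.  The t_ij being
   nilpotent in R, the inverse g of [mu_inv t] exists and is unique. *)
Definition is_pullback U (N : nat) (delta : (Vminus k n -> Vhat k n) -> k)
    (tau : mps (n * N) k) : Prop :=
  forall (R : comAlgType k) (b : nat) (t : 'I_(n * N) -> R),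
    formal_point b t ->
    forall g : Vminus R n, act_minus (mu_inv t) g = [ffun=> 1] ->
    tau_value U delta g (mu_inv t) (mps_eval b t tau).

Definition Delta (N : nat) (j : 'I_n) : mps (n * N) k :=
  \prod_(i < N) \prod_(l < N | (i < l)%N)
    (mps_var k (tidx i j) - mps_var k (tidx l j)).

(* The a-th row is
   (f^a_1(t_11), ..., f^a_1(t_N1), ..., f^a_n(t_1n), ..., f^a_n(t_Nn)). *)
Definition interp_matrix (N : nat) (f : 'I_(n * N) -> Vhat k n) :
    'M[mps (n * N) k]_(n * N) :=
  \matrix_(a < n * N)
    mxvec (\matrix_(j < n, i < N) laurent_subst (tidx i j) (f a j)).

End Pullback.

(* Main.v *)
From HB Require Import structures.
From mathcomp Require Import all_boot all_order all_algebra.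
From mathcomp Require Import mpoly.
From mathcomp Require Import boolp classical_sets.
From mathcomp Require Import zify ring.
Require Import Defs.

Set Implicit Arguments.
Unset Strict Implicit.
Unset Printing Implicit Defensive.

Import Order.TTheory GRing.Theory Num.Theory.
Local Open Scope classical_set_scope.
Local Open Scope ring_scope.

(** The hypothesis on [Omega_+] means that [U] is a complement of [V^+], so that
    [U] has a frame [w] with [w v = v] modulo [V^+] for all [v] in [V^-]
    ([exists_normalized_frame]). On the frames of [U] the generator [delta] is
    [delta w] times the determinant, and the inverse image of [Omega_+] at a
    point [t], with [h] the product of the [1 - t_ij / z] and [g = h^-1], is
    [delta w ^-1] times the finite determinant of [g w h] on [V^-]
    ([tau_valueP]).

    This determinant lives on [F_m] for an [m] that grows with the order of
    nilpotency of the [t_ij]. It is the determinant of a finite rank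
    perturbation of the identity, which factors through [F_N]; by Sylvester's identity
    [det (1 + AB) = det (1 + BA)] it can be computed there
    ([fdet_finite_rank], [fdet_remainder]). The resulting endomorphism of [F_N]
    is the remainder of Weierstrass division by [h]: geometrically, the map
    from [gU] to [V / V^+] is the map from [U] to [V / h V^+], which is
    governed by the map from the intersection of [U] and [z^-N V^+] to
    [z^-N V^+ / h V^+], and [F_N] is a set of representatives of the latter
    quotient.

    Now let [f] be a basis of the intersection of [V^+] and [z^N U], which is
    [z^N w (F_N)] ([mem_Vplus_zshift]). Evaluating at the [t_ij] kills the
    multiples of [z^N h], so the interpolation matrix is the product of a
    constant invertible matrix, of the matrix of the remainder, and of a block
    diagonal matrix with Vandermonde blocks ([interp_matrix_eval]). Taking
    determinants gives the formula, the Vandermonde blocks producing the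
    [Delta_j] ([det_interpolation]).

    All this happens at the points of the formal scheme with values in
    [k]-algebras. A power series is determined by its values at such points,
    because the truncated power series rings are among the algebras
    ([mps_eval_inj]). Conversely the values of the determinant do come from a
    power series, because the matrix of the remainder does: the product of the
    geometric series of the variables [t_ij / z] with a constant series has
    power series coefficients ([universal_remainder_eval]). *)

(** * Determinants *)

(** Sylvester's identity: both sides are the determinant of the block matrix
    with blocks [1, - A; B, 1], computed by the two block eliminations. *)
Lemma det_addmulC (R : comNzRingType) (p q : nat) (A : 'M[R]_(p, q))
    (B : 'M[R]_(q, p)) :
  \det (1%:M + A *m B) = \det (1%:M + B *m A).
Proof.
have E1 : block_mx 1%:M (- A) B 1%:M
    = block_mx 1%:M 0 B 1%:M *m block_mx 1%:M (- A) 0 (1%:M + B *m A).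
  rewrite mulmx_block !mulmx1 !mul1mx !mul0mx !addr0 mulmxN addrCA addNr.
  by rewrite addr0.
have E2 : block_mx 1%:M (- A) B 1%:M
    = block_mx 1%:M (- A) 0 1%:M *m block_mx (1%:M + A *m B) 0 B 1%:M.
  rewrite mulmx_block !mulmx1 !mul1mx !mul0mx !add0r ?addr0 mulNmx.
  by rewrite -addrA subrr addr0 ?mulmx0 ?add0r.
have := congr1 determinant E1; rewrite E2 !det_mulmx !det_ublock !det_lblock.
by rewrite !det1 !mul1r !mulr1.
Qed.

(** The maps below are built from frames, whose linearity is a hypothesis and
    not a canonical structure. *)
Lemma mul_rV_lin1_linear (R : pzRingType) (p q : nat)
    (f : 'rV[R]_p -> 'rV[R]_q) (u : 'rV[R]_p) :
  linear f -> u *m lin1_mx f = f u.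
Proof.
move=> fL; pose F : {linear 'rV[R]_p -> 'rV[R]_q} :=
  HB.pack f (GRing.isLinear.Build R 'rV[R]_p 'rV[R]_q *:%R f fL).
exact: (mul_rV_lin1 F).
Qed.

Lemma eq_mx_rV (R : pzRingType) (p q : nat) (A B : 'M[R]_(p, q)) :
  (forall u : 'rV_p, u *m A = u *m B) -> A = B.
Proof. by move=> AB; apply/row_matrixP => i; rewrite !rowE. Qed.

(** A simultaneous reindexing of rows and columns is a conjugation by a
    permutation matrix. The index types may be different ordinals, so that
    matrix need not be square on its face: Sylvester's identity applies. *)
Lemma det_mxsub_bij (R : comNzRingType) (p q : nat) (f : 'I_p -> 'I_q)
    (A : 'M[R]_q) : bijective f -> \det (mxsub f f A) = \det A.
Proof.
move=> [f' fK f'K].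
pose P : 'M[R]_(p, q) := rowsub f 1%:M.
pose P' : 'M[R]_(q, p) := colsub f 1%:M.
have sub1 r (F : 'M[R]_(r, q)) : F *m P' = colsub f F.
  by rewrite -[in RHS](mulmx1 F) mulmx_colsub.
have sub2 r (F : 'M[R]_(q, r)) : P *m F = rowsub f F.
  by rewrite -[in RHS](mul1mx F) mul_rowsub_mx.
have PP' : P *m P' = 1%:M.
  rewrite sub1; apply/matrixP => i j; rewrite !mxE.
  by rewrite (inj_eq (can_inj fK)).
have P'P : P' *m P = 1%:M.
  apply/matrixP => i j; rewrite !mxE (bigD1 (f' j)) //= big1 ?addr0.
    by rewrite !mxE !f'K eqxx mulr1.
  move=> l lj; rewrite !mxE; have [E|] := eqVneq (f l) j; last by rewrite mulr0.
  by rewrite -E fK eqxx in lj.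
have -> : mxsub f f A = 1%:M + P *m ((A - 1%:M) *m P').
  by rewrite mulmxBl mul1mx mulmxBr PP' addrC subrK sub1 sub2; apply/matrixP => i j; rewrite !mxE.
by rewrite det_addmulC -mulmxA P'P mulmx1 addrC subrK.
Qed.

Lemma mulmx_reindex (R : comNzRingType) (p q r s : nat) (f : 'I_s -> 'I_q)
  (A : 'M[R]_(p, q))  (B : 'M[R]_(q, r)) : bijective f -> A *m B = colsub f A *m rowsub f B.
Proof.
move=> fb; apply/matrixP => i j; rewrite !mxE (reindex f) /=; last exact: onW_bij.
by apply: eq_bigr => l _; rewrite !mxE.
Qed.

(** * The action of polynomials in [z^-1] on Laurent series *)

Section ShiftAction.
Variable R : comNzRingType.
Implicit Types (q : {poly R}) (x : int -> R) (i : int).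

(** The coefficients of [q(z^-1) x]; families unbounded below are allowed,
    because the geometric series in the variables [t_ij] is one. *)
Definition shift_act q x i : R := \sum_(s < size q) q`_s * x (i + s%:Z).

Lemma shift_actE B q x i : (size q <= B)%N ->
  shift_act q x i = \sum_(s < B) q`_s * x (i + s%:Z).
Proof.
move=> qB; rewrite /shift_act.
rewrite [RHS](bigID (fun s : 'I_B => (s < size q)%N)) /= [X in _ + X]big1 ?addr0.
  by rewrite (big_ord_widen _ (fun s => q`_s * x (i + s%:Z)) qB).
by move=> s; rewrite -leqNgt => qs; rewrite nth_default ?mul0r.
Qed.

Lemma eq_shift_act q x y i : x =1 y -> shift_act q x i = shift_act q y i.
Proof. by move=> xy; apply: eq_bigr => s _; rewrite xy. Qed.

Lemma shift_actDl q q' x i :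
  shift_act (q + q') x i = shift_act q x i + shift_act q' x i.
Proof.
pose B := maxn (size q) (size q').
rewrite !(@shift_actE B) ?leq_maxl ?leq_maxr ?size_polyD // -big_split /=.
by apply: eq_bigr => s _; rewrite coefD mulrDl.
Qed.

Lemma shift_actC c x i : shift_act c%:P x i = c * x i.
Proof.
rewrite (@shift_actE 1) ?size_polyC_leq1 // big_ord1 coefC /=.
by rewrite addr0.
Qed.

Lemma shift_act1 x i : shift_act 1 x i = x i.
Proof. by rewrite -[1]/(1%:P) shift_actC mul1r. Qed.

Lemma shift_actMX q x i : shift_act (q * 'X) x i = shift_act q x (i + 1).
Proof.
rewrite (@shift_actE (size q).+1); last first.
  by rewrite (leq_trans (size_polyMleq _ _)) // size_polyX addn2.
rewrite big_ord_recl coefMX /= mul0r add0r; apply: eq_bigr => s _.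
by rewrite coefMX /= -addrA.
Qed.

Lemma shift_actMC q c x i : shift_act (c *: q) x i = c * shift_act q x i.
Proof.
rewrite (@shift_actE (size q)) ?size_scale_leq // /shift_act mulr_sumr.
by apply: eq_bigr => s _; rewrite coefZ mulrA.
Qed.

Lemma shift_actM q q' x i :
  shift_act (q * q') x i = shift_act q (shift_act q' x) i.
Proof.
elim/poly_ind: q i => [|q c IH] i.
  by rewrite mul0r -[0]/(0%:P) !shift_actC !mul0r.
rewrite mulrDl !shift_actDl shift_actC mulrAC !shift_actMX IH.
by rewrite mul_polyC shift_actMC.
Qed.

Lemma shift_act_lin q a x y i :
  shift_act q (fun i => a * x i + y i) i = a * shift_act q x i + shift_act q y i.
Proof.
rewrite /shift_act mulr_sumr -big_split; apply: eq_bigr => s _ /=.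
by rewrite mulrDr mulrCA.
Qed.

Lemma shift_act_linear c x i :
  shift_act (1 - c *: 'X) x i = x i - c * x (i + 1).
Proof.
rewrite -scaleNr shift_actDl shift_act1 shift_actMC -['X]mul1r shift_actMX.
by rewrite shift_act1 mulNr.
Qed.

End ShiftAction.

(** * Principal parts *)

Lemma Negz_add_le (i s : nat) : (s <= i)%N -> Negz i + s%:Z = Negz (i - s).
Proof. lia. Qed.

Lemma Negz_add_gt (i s : nat) : (i < s)%N -> Negz i + s%:Z = Posz (s - i.+1).
Proof. lia. Qed.

Section PrincipalPart.
Variables (R : comNzRingType) (n : nat).
Implicit Types (x y : Vhat R n) (q v g h : Vminus R n).

Lemma VhatP x y : (forall j i, x j i = y j i) -> x = y.
Proof. by move=> xy; apply/ffunP => j; apply/laurentext => i. Qed.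

Lemma VminusP q v : (forall j a, (q j)`_a = (v j)`_a) -> q = v.
Proof. by move=> qv; apply/ffunP => j; apply/polyP => a. Qed.

Lemma coef_VminusD q v j a : ((q + v) j)`_a = (q j)`_a + (v j)`_a.
Proof. by rewrite ffunE coefD. Qed.

Lemma coef_VminusB q v j a : ((q - v) j)`_a = (q j)`_a - (v j)`_a.
Proof. by rewrite ffunE coefD ffunE coefN. Qed.

Lemma coef_VminusZ c q j a : ((c *: q) j)`_a = c * (q j)`_a.
Proof. by rewrite ffunE coefZ. Qed.

Lemma VhatD x y j i : (x + y) j i = x j i + y j i.
Proof. by rewrite ffunE. Qed.

Lemma VhatN x j i : (- x) j i = - x j i.
Proof. by rewrite ffunE. Qed.

Lemma VhatB x y j i : (x - y) j i = x j i - y j i.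
Proof. by rewrite VhatD VhatN. Qed.

Lemma VhatZ a x j i : (a *: x) j i = a * x j i.
Proof. by rewrite ffunE. Qed.

Lemma Vhat0 j i : (0 : Vhat R n) j i = 0.
Proof. by rewrite ffunE. Qed.

Lemma Vhat_sum I r (P : pred I) (F : I -> Vhat R n) j i :
  (\sum_(a <- r | P a) F a) j i = \sum_(a <- r | P a) F a j i.
Proof.
by elim/big_rec2: _ => [|a y1 y2 _ <-]; rewrite ?Vhat0 ?VhatD.
Qed.

Lemma iotaE q j i : iota q j i = if i is Negz a then (q j)`_a else 0.
Proof. by rewrite ffunE. Qed.

Lemma actE g x j i : act g x j i = shift_act (g j) (x j) i.
Proof. by rewrite ffunE. Qed.

(** The projection of [V] onto [V^-] along [V^+]. A bound on the order of the
    poles exists but is not part of the data, hence the choice. *)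
Definition pole x : Vminus R n :=
  [ffun j => \poly_(a < `|projT1 (cid (lcoefP (x j)))|) x j (Negz a)].

Lemma coef_pole x j a : (pole x j)`_a = x j (Negz a).
Proof.
rewrite ffunE coef_poly; case: cid => m xm /=; case: ltnP => // ma.
by rewrite xm //; lia.
Qed.

Fact iota_is_linear : linear (@iota R n).
Proof.
move=> a q v; apply/VhatP => j i; rewrite VhatD VhatZ !iotaE.
case: i => i; first by rewrite mulr0 addr0.
by rewrite !ffunE coefD coefZ.
Qed.
HB.instance Definition _ :=
  GRing.isLinear.Build R (Vminus R n) (Vhat R n) *:%R (@iota R n) iota_is_linear.

Fact pole_is_linear : linear pole.
Proof.
move=> a x y; apply/VminusP => j i.
by rewrite [in RHS]ffunE [in RHS]ffunE coefD coefZ !coef_pole VhatD VhatZ.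
Qed.
HB.instance Definition _ :=
  GRing.isLinear.Build R (Vhat R n) (Vminus R n) *:%R pole pole_is_linear.

Fact act_is_linear g : linear (act g).
Proof.
move=> a x y; apply/VhatP => j i; rewrite VhatD VhatZ !actE -shift_act_lin.
by apply: eq_shift_act => l; rewrite VhatD VhatZ.
Qed.
HB.instance Definition _ g := GRing.isLinear.Build R (Vhat R n) (Vhat R n)
  *:%R (act g) (act_is_linear g).

Fact act_minus_is_linear g : linear (act_minus g).
Proof.
move=> a x y; apply/ffunP => j.
by rewrite !ffunE mulrDr scalerAr.
Qed.
HB.instance Definition _ g := GRing.isLinear.Build R (Vminus R n) (Vminus R n)
  *:%R (act_minus g) (act_minus_is_linear g).

Lemma iotaK : cancel (@iota R n) pole.
Proof. by move=> q; apply/VminusP => j a; rewrite coef_pole iotaE. Qed.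

Lemma zVplus_pole (m : nat) x :
  zVplus (- m%:Z) x <-> forall j a, (m <= a)%N -> (pole x j)`_a = 0.
Proof.
split=> [xm j a ma|xm j [i|a] im].
- by rewrite coef_pole xm //; lia.
- by exfalso; move: im; rewrite ltNge; lia.
by rewrite -coef_pole xm //; lia.
Qed.

Lemma Vplus_pole x : Vplus x <-> pole x = 0.
Proof.
split=> [/(zVplus_pole 0) x0|x0].
  by apply/VminusP => j a; rewrite x0 // ffunE coef0.
by apply/(zVplus_pole 0) => j a _; rewrite x0 ffunE coef0.
Qed.

Lemma act_iota g v : act g (iota v) = iota (act_minus g v).
Proof.
apply/VhatP => j i; rewrite actE iotaE; case: i => i.
  by apply: big1 => s _; rewrite iotaE mulr0.
rewrite [in RHS]ffunE coefM (@shift_actE _ (size (g j) + i.+1)) ?leq_addr //.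
rewrite (big_ord_widen _ (fun s => (g j)`_s * (v j)`_(i - s))
           (leq_addl (size (g j)) i.+1)).
rewrite [RHS]big_mkcond; apply: eq_bigr => s _ /=; rewrite iotaE ltnS.
case: leqP => si.
  by rewrite Negz_add_le.
by rewrite Negz_add_gt ?mulr0.
Qed.

Lemma act_comp g h x : act g (act h x) = act (act_minus g h) x.
Proof.
apply/VhatP => j i; rewrite !actE [in RHS]ffunE shift_actM.
by apply: eq_shift_act => l; rewrite actE.
Qed.

Lemma act_minus_comp g h v : act_minus g (act_minus h v) = act_minus (act_minus g h) v.
Proof. by apply/ffunP => j; rewrite !ffunE mulrA. Qed.

Lemma act_minusC g h : act_minus g h = act_minus h g.
Proof. by apply/ffunP => j; rewrite !ffunE mulrC. Qed.

Lemma act_minus1 v : act_minus [ffun=> 1] v = v.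
Proof. by apply/ffunP => j; rewrite !ffunE mul1r. Qed.

Lemma act1 x : act [ffun=> 1] x = x.
Proof. by apply/VhatP => j i; rewrite actE ffunE shift_act1. Qed.

Section Inverse.
Variables g h : Vminus R n.
Hypothesis hg : act_minus h g = [ffun=> 1].

Lemma actK : cancel (act g) (act h).
Proof. by move=> x; rewrite act_comp hg act1. Qed.

Lemma act_minusK : cancel (act_minus g) (act_minus h).
Proof. by move=> x; rewrite act_minus_comp hg act_minus1. Qed.

End Inverse.

(** Multiplication by a polynomial of degree [d] in [z^-1] creates poles of
    order at most [d]; the coefficient of index [a] belongs to [z^-(a + 1)]. *)
Lemma pole_act_Vplus d h x j a : (forall j, size (h j) <= d.+1)%N -> Vplus x ->
  (d <= a)%N -> (pole (act h x) j)`_a = 0.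
Proof.
move=> hd xV da; rewrite coef_pole actE; apply: big1 => s _.
have sd : (s <= a)%N.
  by rewrite -ltnS (leq_trans (ltn_ord s)) // (leq_trans (hd j)).
by rewrite Negz_add_le // xV ?mulr0.
Qed.

(** ** Coordinates on [F_m] *)

Fact Fm_is_linear m : linear (@Fm R n m).
Proof.
move=> a u v; apply/ffunP => j; rewrite !ffunE scaler_sumr -big_split.
by apply: eq_bigr => i _ /=; rewrite !mxE scalerDl scalerA.
Qed.
HB.instance Definition _ m := GRing.isLinear.Build R 'rV[R]_(m * n)
  (Vminus R n) *:%R (@Fm R n m) (@Fm_is_linear m).

Fact principal_part_is_linear m : linear (@principal_part R n m).
Proof.
move=> a x y; rewrite /principal_part -linearP; congr mxvec.
by apply/matrixP => i j; rewrite !mxE VhatD VhatZ.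
Qed.
HB.instance Definition _ m := GRing.isLinear.Build R (Vhat R n)
  'rV[R]_(m * n) *:%R (@principal_part R n m) (@principal_part_is_linear m).

Lemma coef_Fm m (u : 'rV[R]_(m * n)) j a :
  (Fm u j)`_a = if insub a is Some b then u 0 (mxvec_index b j) else 0.
Proof.
rewrite ffunE coef_sum; case: insubP => [b _ ba|am].
  rewrite (bigD1 b) //= coefZ coefXn ba eqxx mulr1 big1 ?addr0 // => i ib.
  by rewrite coefZ coefXn -ba eq_sym (inj_eq val_inj) (negbTE ib) mulr0.
apply: big1 => i _; rewrite coefZ coefXn; case: eqP => [ai|]; rewrite ?mulr0 //.
by rewrite ai ltn_ord in am.
Qed.

Lemma Fm_ge m (u : 'rV[R]_(m * n)) j a : (m <= a)%N -> (Fm u j)`_a = 0.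
Proof. by move=> ma; rewrite coef_Fm insubN // -leqNgt. Qed.

Lemma Fm_lt m (u : 'rV[R]_(m * n)) j (a : 'I_m) :
  (Fm u j)`_a = u 0 (mxvec_index a j).
Proof. by rewrite coef_Fm valK. Qed.

Lemma principal_partE m x (a : 'I_m) (j : 'I_n) :
  principal_part m x 0 (mxvec_index a j) = x j (Negz a).
Proof. by rewrite mxvecE mxE. Qed.

Lemma principal_part_pole m x : principal_part m (iota (pole x)) = principal_part m x.
Proof.
apply/rowP => l; case: (mxvec_indexP l) => a j.
by rewrite !principal_partE iotaE coef_pole.
Qed.

Lemma principal_part_Fm m (u : 'rV[R]_(m * n)) : principal_part m (iota (Fm u)) = u.
Proof.
apply/rowP => l; case: (mxvec_indexP l) => a j.
by rewrite !principal_partE iotaE Fm_lt.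
Qed.

Lemma Fm_principal_part m x : zVplus (- m%:Z) x ->
  Fm (principal_part m x) = pole x.
Proof.
move=> xm; apply/VminusP => j a; rewrite coef_Fm; case: insubP => [b _ <-|].
  by rewrite principal_partE coef_pole.
by rewrite -leqNgt => ma; rewrite (zVplus_pole m x).1.
Qed.

Lemma congr_id_le m m' w : (m <= m')%N -> congr_id m w -> @congr_id R n m' w.
Proof. by move=> mm' wm v j i im; apply: wm; lia. Qed.

Lemma congr_id_pole m w v : congr_id m w ->
  @pole (w v) = v + Fm (principal_part m (w v - iota v)).
Proof.
by move=> /(_ v)/Fm_principal_part ->; rewrite linearB /= iotaK addrC subrK.
Qed.

End PrincipalPart.

Arguments pole {R n} x.

(** * Finite determinants *)

Section FiniteDeterminant.
Variables (R : comNzRingType) (n : nat).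
Implicit Types (w : Vminus R n -> Vhat R n) (T : Vminus R n -> Vminus R n).

(** [fdet] evaluates this at a level [m] picked by choice. *)
Definition detm m w : R :=
  \det (lin1_mx (fun u => principal_part m (w (@Fm R n m u)))).

Lemma linear_sub_iota w : linear w -> linear (fun v => w v - iota v).
Proof.
move=> wL a u v; rewrite wL iota_is_linear scalerBr opprD !addrA; congr (_ - _).
by rewrite -!addrA; congr (_ + _); rewrite addrC.
Qed.

(** In the basis of [F_m] the map is [1 + A B], with [A] the matrix of [alpha] on
    [F_m] and [B] that of [beta]. Exchanging the factors leaves a matrix that
    does not depend on [m]. *)
Lemma detm_finite_rank d m w (alpha : Vminus R n -> 'rV[R]_d)
    (beta : 'rV[R]_d -> Vminus R n) :
    linear w -> linear alpha -> linear beta ->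
    (forall v, pole (w v) = v + beta (alpha v)) ->
    (forall u j a, (m <= a)%N -> (beta u j)`_a = 0) ->
  detm m w = \det (1%:M + lin1_mx (fun u => alpha (beta u))).
Proof.
move=> wL aL bL wE bm.
pose A := lin1_mx (fun u => alpha (@Fm R n m u)).
pose B := lin1_mx (fun u => principal_part m (iota (beta u))).
have mulA u : u *m A = alpha (Fm u).
  by rewrite mul_rV_lin1_linear // => c x y; rewrite Fm_is_linear aL.
have mulB u : u *m B = principal_part m (iota (beta u)).
  rewrite mul_rV_lin1_linear // => c x y.
  by rewrite bL iota_is_linear principal_part_is_linear.
have -> : lin1_mx (fun u => alpha (beta u)) = B *m A.
  apply: eq_mx_rV => u; rewrite mulmxA mulB mulA mul_rV_lin1_linear //.
    rewrite Fm_principal_part ?iotaK //; apply/zVplus_pole => j a ma.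
    by rewrite iotaK bm.
  by move=> c x y; rewrite bL aL.
rewrite -det_addmulC; congr determinant; apply: eq_mx_rV => u.
rewrite mul_rV_lin1_linear; last first.
  by move=> c x y; rewrite Fm_is_linear wL principal_part_is_linear.
rewrite mulmxDr mulmx1 mulmxA mulA mulB -principal_part_pole wE.
by rewrite (raddfD iota) (raddfD (principal_part m)) /= principal_part_Fm.
Qed.

(** The coordinates of [w v - v] in [F_m], when [w] is congruent to the identity
    modulo [z^-m V^+]. *)
Definition defect m w v : 'rV[R]_(m * n) := principal_part m (w v - iota v).

Lemma defect_linear m w : linear w -> linear (defect m w).
Proof. by move=> wL a u v; rewrite /defect (linear_sub_iota wL) principal_part_is_linear. Qed.

(** The defect of [w] at level [m1] has values in [F_m1], hence in [F_m2] for
    every [m2 >= m1], and both determinants are computed by it. *)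
Lemma fdetE m w : linear w -> congr_id m w -> fdet w = detm m w.
Proof.
move=> wL; have detm_le m1 m2 : (m1 <= m2)%N -> congr_id m1 w ->
    detm m1 w = detm m2 w.
  move=> m12 wm; pose Fm1 := @Fm R n m1.
  have FL : linear Fm1 := @Fm_is_linear R n m1.
  have dL : linear (defect m1 w) := defect_linear _ wL.
  have wE v : pole (w v) = v + Fm1 (defect m1 w v) := congr_id_pole v wm.
  rewrite (detm_finite_rank (m := m1) wL dL FL wE) => [|u j a ma]; last first.
    exact: Fm_ge.
  rewrite (detm_finite_rank (m := m2) wL dL FL wE) // => u j a ma.
  by rewrite Fm_ge // (leq_trans m12).
move=> wm; rewrite /fdet.
set m0 := xget _ _; have wm0 : congr_id m0 w by exact: (@xgetPex _ 0%N
  [set m | congr_id m w] (ex_intro _ m wm)).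
rewrite -[LHS]/(detm m0 w) (detm_le _ _ (leq_maxl m0 m)) //.
by rewrite (detm_le _ _ (leq_maxr m0 m)).
Qed.

(** A finite family of elements of [V^-] has bounded poles, so the image of
    [beta] lies in some [F_m], and Sylvester's identity applies there. *)
Lemma fdet_finite_rank d w (alpha : Vminus R n -> 'rV[R]_d)
    (beta : 'rV[R]_d -> Vminus R n) :
    linear w -> linear alpha -> linear beta ->
    (forall v, pole (w v) = v + beta (alpha v)) ->
  fdet w = \det (1%:M + lin1_mx (fun u => alpha (beta u))).
Proof.
move=> wL aL bL wE.
pose m := (\max_(i < d) \max_(j < n) size (beta (delta_mx ord0 i) j))%N.
have bm u j a : (m <= a)%N -> (beta u j)`_a = 0.
  pose b' : {linear 'rV[R]_d -> Vminus R n} :=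
    HB.pack beta (GRing.isLinear.Build R 'rV[R]_d (Vminus R n) *:%R beta bL).
  move=> ma; rewrite -[beta]/(b' : _ -> _) [u]row_sum_delta linear_sum /=.
  rewrite sum_ffunE coef_sum big1 // => i _.
  rewrite -[beta]/(b' : _ -> _) linearZ /= ffunE coefZ nth_default ?mulr0 //.
  apply: leq_trans ma.
  apply: leq_trans (leq_bigmax (F := fun i : 'I_d =>
    \max_(j < n) size (beta (delta_mx ord0 i) j)) i).
  exact: (leq_bigmax (F := fun j : 'I_n => size (beta (delta_mx ord0 i) j))).
rewrite (@fdetE m) // ?(detm_finite_rank wL aL bL wE bm) // => v.
by apply/zVplus_pole => j a ma; rewrite (raddfB pole) /= iotaK wE addrC addKr bm.
Qed.

Lemma fdet_pole w w' : linear w -> linear w' -> (exists m, congr_id m w) ->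
  (forall v, pole (w v) = pole (w' v)) -> fdet w = fdet w'.
Proof.
move=> wL wL' [m wm] ww'.
have wm' : congr_id m w'.
  move=> v; have /zVplus_pole wv := wm v; apply/zVplus_pole => j a ma.
  by have := wv j a ma; rewrite !(raddfB pole) /= ww'.
have FL : linear (@Fm R n m) := @Fm_is_linear R n m.
have dL : linear (defect m w) := defect_linear _ wL.
rewrite (fdet_finite_rank wL dL FL (fun v => congr_id_pole v wm)).
rewrite (fdet_finite_rank wL' dL FL) // => v.
by rewrite -ww'; apply: congr_id_pole.
Qed.

(** [T] preserves [F_m], so the matrices of [T] and of [w] on [F_m] multiply. *)
Lemma fdet_comp m w T : linear w -> linear T ->
    congr_id m w -> congr_id m (iota \o T) ->
  fdet (w \o T) = fdet (iota \o T) * fdet w.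
Proof.
move=> wL TL wm Tm.
have wTL : linear (w \o T) by move=> a u v /=; rewrite TL wL.
have iTL : linear (iota \o T) by move=> a u v /=; rewrite TL iota_is_linear.
have TF (u : 'rV[R]_(m * n)) : Fm (principal_part m (iota (T (Fm u)))) = T (Fm u).
  rewrite Fm_principal_part ?iotaK //; apply/zVplus_pole => j a ma.
  have /zVplus_pole/(_ j a ma) := Tm (Fm u).
  by rewrite (raddfB pole) /= !iotaK coef_VminusB (Fm_ge u j ma) subr0.
have wTm : congr_id m (w \o T).
  move=> v j i im; have := wm (T v) j i im; have := Tm v j i im.
  rewrite !VhatB /= => /eqP; rewrite subr_eq0 => /eqP <- /eqP.
  by rewrite subr_eq0 => /eqP <-; rewrite subrr.
rewrite !(@fdetE m) // -det_mulmx; congr determinant.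
have cL (w0 : Vminus R n -> Vhat R n) : linear w0 ->
    linear (fun u => principal_part m (w0 (@Fm R n m u))).
  by move=> w0L a u v; rewrite Fm_is_linear w0L principal_part_is_linear.
apply: eq_mx_rV => u; rewrite mulmxA.
by rewrite !mul_rV_lin1_linear ?TF //; apply: cL.
Qed.

(** The maps [T] and [g T g^-1] are finite rank perturbations of the identity
    with conjugate defects; [g] does not preserve any [F_m], so this is again
    an instance of Sylvester's identity. *)
Lemma fdet_conj m (g h : Vminus R n) T : act_minus h g = [ffun=> 1] ->
    linear T -> congr_id m (iota \o T) ->
  fdet (fun v => iota (act_minus g (T (act_minus h v)))) = fdet (iota \o T).
Proof.
move=> hg TL Tm.
have gh : act_minus g h = [ffun=> 1] by rewrite act_minusC.
have iTL : linear (iota \o T) by move=> a u v /=; rewrite TL iota_is_linear.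
pose eps := defect m (iota \o T).
have epsL : linear eps := defect_linear _ iTL.
have FL : linear (@Fm R n m) := @Fm_is_linear R n m.
have TE v : T v = v + Fm (eps v).
  by rewrite -(congr_id_pole v Tm) /= iotaK.
rewrite (fdet_finite_rank iTL epsL FL) => [|v]; last by rewrite /= iotaK.
rewrite (@fdet_finite_rank _ _ (eps \o act_minus h) (act_minus g \o @Fm R n m)).
- by congr (\det (1%:M + lin1_mx _)); apply/funext => u /=; rewrite (act_minusK hg).
- by move=> a u v; rewrite act_minus_is_linear TL act_minus_is_linear iota_is_linear.
- by move=> a u v /=; rewrite act_minus_is_linear epsL.
- by move=> a u v /=; rewrite Fm_is_linear act_minus_is_linear.
by move=> v /=; rewrite iotaK TE (raddfD (act_minus g)) /= (act_minusK gh).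
Qed.

End FiniteDeterminant.

(** * Frames *)

Section Frames.
Variables (R : comNzRingType) (n : nat).
Implicit Types (L : set (Vhat R n)) (w : Vminus R n -> Vhat R n).

(** A normalized frame is a section of the projection of [V] onto [V^-]; its
    range is a complement of [V^+], and it is the only such section with that
    range. *)
Definition normalized w := forall v, pole (w v) = v.

Lemma normalized_congr_id m w : normalized w -> congr_id m w.
Proof.
move=> wE v; apply/zVplus_pole => j a _.
by rewrite (raddfB pole) /= iotaK wE subrr ffunE coef0.
Qed.

Lemma normalized_frame L w :
  linear w -> normalized w -> range w = L -> frame L w.
Proof.
move=> wL wE wr; split=> // [u v uv|]; first by rewrite -[u]wE uv wE.
by exists 0%N; apply: normalized_congr_id.
Qed.

Lemma frame_factor L w1 w : frame L w1 -> normalized w1 -> frame L w ->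
  w = w1 \o (pole \o w).
Proof.
move=> [_ _ w1r _] w1E [_ _ wr _]; apply/funext => v /=.
have : L (w v) by rewrite -wr; exists v.
by rewrite -w1r => -[u _ wu]; rewrite -wu w1E.
Qed.

(** A normalized frame [w1] is a base point: every frame [w] is [w1 \o T] with
    [T = pole \o w], and the determinant of [T] is that of [w]. *)
Lemma det_dual_normalized L s w1 w : det_dual L s ->
  frame L w1 -> normalized w1 -> frame L w -> s w = s w1 * fdet w.
Proof.
move=> sL w1F w1E wF; have wfac := frame_factor w1F w1E wF.
rewrite {1}wfac sL -?wfac // mulrC; congr (_ * _).
have [wL _ _ [m wm]] := wF.
apply: fdet_pole => // [a u v /=||v /=]; last by rewrite iotaK.
  by rewrite wL pole_is_linear iota_is_linear.
exists m => v; have /zVplus_pole wv := wm v; apply/zVplus_pole => j a ma.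
by have := wv j a ma; rewrite !(raddfB pole) /= !iotaK.
Qed.

Lemma det_dual_fdet L c : det_dual L (fun w => c * fdet w).
Proof.
move=> w T [wL wI wr [m wm]] [wTL _ _ [m' wTm]].
have TL : linear T by move=> a u v; apply: wI; rewrite wL; apply: wTL.
pose M := maxn m m'.
rewrite (@fdet_comp _ _ M) // ?(mulrCA c) //.
  exact: congr_id_le (leq_maxl _ _) wm.
move=> v; apply/zVplus_pole => j a Ma.
have [ma m'a] : (m <= a /\ m' <= a)%N by move: Ma; rewrite /M; lia.
have /zVplus_pole/(_ j a ma) := wm (T v).
have /zVplus_pole/(_ j a m'a) := wTm v.
rewrite !(raddfB pole) /= !coef_VminusB !iotaK => /eqP; rewrite subr_eq0.
by move=> /eqP -> /eqP; rewrite subr_eq0 => /eqP ->; rewrite subrr.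
Qed.

End Frames.

(** If [w] is a frame with nonzero determinant then [T = pole \o w] is the sum
    of the identity and a map into [F_m], and it is invertible on [F_m]; hence
    it is invertible and [w \o T^-1] is a normalized frame. *)
Lemma exists_normalized_frame (k : fieldType) (n : nat) (L : set (Vhat k n)) w :
  frame L w -> fdet w != 0 -> exists2 w1, frame L w1 & normalized w1.
Proof.
move=> [wL _ wr [m wm]]; rewrite (fdetE wL wm) /detm.
set A := lin1_mx _ => A0.
have Aunit : A \in unitmx by rewrite unitmxE unitfE.
have mulA u : u *m A = principal_part m (w (Fm u)).
  rewrite mul_rV_lin1_linear // => c x y.
  by rewrite Fm_is_linear wL principal_part_is_linear.
pose eps := defect m w.
have epsL : linear eps := defect_linear _ wL.
have TE v : pole (w v) = v + Fm (eps v) := congr_id_pole v wm.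
have epsF u : eps (Fm u) = u *m A - u.
  by rewrite /eps /defect (raddfB (principal_part m)) /= principal_part_Fm mulA.
have epsD x y : eps (x + y) = eps x + eps y.
  by rewrite -[x]scale1r epsL !scale1r.
have epsB x y : eps (x - y) = eps x - eps y.
  by rewrite addrC -scaleN1r epsL scaleN1r addrC.
pose S v := v - Fm (eps v *m invmx A).
have SL : linear S.
  move=> a u v; rewrite /S epsL mulmxDl -scalemxAl Fm_is_linear scalerBr opprD.
  by rewrite !addrA; congr (_ - _); rewrite -!addrA; congr (_ + _); rewrite addrC.
have wSE : normalized (w \o S).
  by move=> v /=; rewrite TE /S epsB epsF mulmxKV // subKr subrK.
exists (w \o S) => //; apply: normalized_frame => //.
  by move=> a u v /=; rewrite SL wL.
rewrite eqEsubset; split=> [_ [v _ <-]|x]; first by rewrite -wr; exists (S v).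
rewrite -wr => -[v _ <-]; exists (pole (w v)) => //=; congr w.
by rewrite /S TE epsD epsF [eps v + _]addrC subrK mulmxK // addrK.
Qed.

(** * Base change *)

Lemma submoduleP (R : comNzRingType) (n : nat) (L : set (Vhat R n)) :
  submodule L <-> L 0 /\ forall a u v, L u -> L v -> L (a *: u + v).
Proof.
split=> [[L0 LD]|[L0 LD]]; split.
- by move: L0; rewrite !inE.
- by move=> a u v Lu Lv; have := LD a u v; rewrite !inE; apply.
- by rewrite !inE.
by move=> a u v; rewrite !inE; apply: LD.
Qed.

Lemma submoduleZ (R : comNzRingType) (n : nat) (L : set (Vhat R n)) a u :
  submodule L -> L u -> L (a *: u).
Proof. by move=> /submoduleP[L0 LD] Lu; rewrite -[_ *: _]addr0; apply: LD. Qed.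

Lemma submodule_sum (R : comNzRingType) (n : nat) (L : set (Vhat R n))
    (I : Type) (r : seq I) (x : I -> Vhat R n) :
  submodule L -> (forall i, L (x i)) -> L (\sum_(i <- r) x i).
Proof.
move=> /submoduleP[L0 LD] Lx; elim/big_rec: _ => // i y _ Ly.
by rewrite -[x i]scale1r; apply: LD.
Qed.

Section Monomials.
Variables (R : nzRingType) (n : nat).

Definition Vminus_mono (j : 'I_n) (a : nat) : Vminus R n :=
  [ffun j' => if j' == j then 'X^a else 0].

Lemma coef_Vminus_mono j a j' b :
  (Vminus_mono j a j')`_b = ((j' == j) && (b == a))%:R.
Proof. by rewrite ffunE; case: eqP => _; rewrite ?coefXn ?coef0. Qed.

Lemma Vminus_bound (v : Vminus R n) : exists B, forall j, (size (v j) <= B)%N.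
Proof.
exists (\max_(j in 'I_n) size (v j))%N => j.
exact: (leq_bigmax (F := fun j => size (v j))).
Qed.

Lemma sum_coef_mono (S : nmodType) (c : 'I_n -> nat -> S) B (j : 'I_n) (b : nat) :
  (b < B)%N ->
  \sum_(j' < n) \sum_(a < B) c j' a *+ ((j == j') && (b == a)) = c j b.
Proof.
move=> bB; rewrite (bigD1 j) //= [X in _ + X]big1 ?addr0 => [|j' jj'].
  rewrite (bigD1 (Ordinal bB)) //= !eqxx mulr1n big1 ?addr0 // => a.
  by rewrite -val_eqE /= eq_sym => /negbTE ->.
by rewrite big1 // => a _; rewrite eq_sym (negbTE jj').
Qed.

Lemma Vminus_expand B (v : Vminus R n) : (forall j, size (v j) <= B)%N ->
  v = \sum_(j < n) \sum_(a < B) (v j)`_a *: Vminus_mono j a.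
Proof.
move=> vB; apply/ffunP => j; apply/polyP => b.
rewrite sum_ffunE coef_sum.
transitivity (\sum_(j' < n) \sum_(a < B)
    (v j')`_a *+ ((j == j') && (b == a))); last first.
  apply: eq_bigr => j' _; rewrite sum_ffunE coef_sum; apply: eq_bigr => a _.
  by rewrite ffunE coefZ coef_Vminus_mono mulr_natr.
case: (ltnP b B) => bB; first by rewrite (sum_coef_mono (fun j a => (v j)`_a)).
rewrite nth_default ?(leq_trans (vB j)) // big1 // => j' _; rewrite big1 // => a _.
by rewrite (gtn_eqF (leq_trans (ltn_ord a) bB)) andbF.
Qed.

End Monomials.

Arguments Vminus_mono {R n}.

Section BaseChange.
Variables (k : fieldType) (n : nat) (R : comAlgType k).
Implicit Types (w : Vminus k n -> Vhat k n) (v : Vminus R n).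

Lemma VmapE (x : Vhat k n) j i : Vmap R x j i = (x j i)%:A.
Proof. by rewrite ffunE. Qed.

(** The [R]-linear extension of [w], defined on the basis of monomials. *)
Definition extend w v : Vhat R n :=
  \sum_(j < n) \sum_(a < size (v j)) (v j)`_a *: Vmap R (w (Vminus_mono j a)).

Lemma extendE B w v : (forall j, size (v j) <= B)%N -> extend w v =
  \sum_(j < n) \sum_(a < B) (v j)`_a *: Vmap R (w (Vminus_mono j a)).
Proof.
move=> vB; apply: eq_bigr => j _.
rewrite (big_ord_widen _ (fun a => (v j)`_a *: Vmap R (w (Vminus_mono j a))) (vB j)).
rewrite big_mkcond; apply: eq_bigr => a _; case: ltnP => // va.
by rewrite nth_default // scale0r.
Qed.

Lemma extend_linear w : linear (extend w).
Proof.
move=> c u v; have [B1 uB] := Vminus_bound u; have [B2 vB] := Vminus_bound v.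
have [B3 cB] := Vminus_bound (c *: u + v).
pose B := (B1 + B2 + B3)%N.
have uB' j : (size (u j) <= B)%N by apply: leq_trans (uB j) _; rewrite /B; lia.
have vB' j : (size (v j) <= B)%N by apply: leq_trans (vB j) _; rewrite /B; lia.
have cB' j : (size ((c *: u + v)%R j) <= B)%N.
  by apply: leq_trans (cB j) _; rewrite /B; lia.
rewrite (extendE w uB') (extendE w vB') (extendE w cB').
rewrite scaler_sumr -big_split; apply: eq_bigr => j _ /=.
rewrite scaler_sumr -big_split; apply: eq_bigr => a _ /=.
by rewrite coef_VminusD coef_VminusZ scalerDl scalerA.
Qed.

Lemma Vminus_map_coef (u : Vminus k n) j a :
  (Vminus_map R u j)`_a = ((u j)`_a)%:A.
Proof. by rewrite ffunE coef_map. Qed.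

Lemma Vminus_map_mono (j : 'I_n) a :
  Vminus_map R (Vminus_mono j a) = Vminus_mono j a.
Proof.
apply/VminusP => j' b; rewrite Vminus_map_coef !coef_Vminus_mono.
exact: (rmorph_nat (in_alg R)).
Qed.

Lemma extend_map w u : linear w -> extend w (Vminus_map R u) = Vmap R (w u).
Proof.
move=> wL; have [B1 uB] := Vminus_bound u.
have [B2 vB] := Vminus_bound (Vminus_map R u).
pose B := (B1 + B2)%N.
rewrite (@extendE B); last by move=> j; apply: leq_trans (vB j) _; rewrite /B; lia.
have uE := @Vminus_expand _ _ B u (fun j => leq_trans (uB j) (leq_addr _ _)).
pose w' : {linear Vminus k n -> Vhat k n} :=
  HB.pack w (GRing.isLinear.Build k (Vminus k n) (Vhat k n) *:%R w wL).
rewrite {2}uE -[w]/(w' : _ -> _) linear_sum.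
apply/VhatP => j i; rewrite VmapE !Vhat_sum scaler_suml; apply: eq_bigr => j' _.
rewrite linear_sum !Vhat_sum scaler_suml; apply: eq_bigr => a _ /=.
rewrite VhatZ VmapE -[w]/(w' : _ -> _) linearZ /= VhatZ Vminus_map_coef.
by rewrite mulr_algl scalerA.
Qed.

Lemma extend_unique w (wR : Vminus R n -> Vhat R n) : linear wR ->
  (forall u, wR (Vminus_map R u) = Vmap R (w u)) -> wR = extend w.
Proof.
move=> wRL wRw; apply/funext => v; have [B vB] := Vminus_bound v.
pose w' : {linear Vminus R n -> Vhat R n} :=
  HB.pack wR (GRing.isLinear.Build R (Vminus R n) (Vhat R n) *:%R wR wRL).
rewrite (@extendE B) // {1}(Vminus_expand vB) -[wR]/(w' : _ -> _) linear_sum.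
apply: eq_bigr => j _; rewrite linear_sum; apply: eq_bigr => a _ /=.
by rewrite -[wR]/(w' : _ -> _) linearZ /= -wRw Vminus_map_mono.
Qed.

(** Stated for a single coordinate of the principal part, so that it serves both
    for [normalized] and for [congr_id]. *)
Lemma coef_pole_extend w j b :
  (forall u, (pole (w u) j)`_b = (u j)`_b) ->
  forall v, (pole (extend w v) j)`_b = (v j)`_b.
Proof.
move=> wE v; have [B vB] := Vminus_bound v; rewrite (@extendE (B + b.+1)); last first.
  by move=> j'; apply: leq_trans (vB j') _; lia.
rewrite coef_pole Vhat_sum -(sum_coef_mono (fun j a => (v j)`_a) (B := B + b.+1)).
  apply: eq_bigr => j' _; rewrite Vhat_sum; apply: eq_bigr => a _.
  rewrite VhatZ VmapE -coef_pole wE coef_Vminus_mono scaler_nat.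
  by rewrite mulr_natr.
by rewrite addnS ltnS leq_addl.
Qed.

Lemma extend_normalized w : normalized w -> normalized (extend w).
Proof.
by move=> wE v; apply/VminusP => j b; apply: coef_pole_extend => u; rewrite wE.
Qed.

Lemma extend_congr_id m w : congr_id m w -> congr_id m (extend w).
Proof.
move=> wm v; apply/zVplus_pole => j a ma.
rewrite (raddfB pole) /= coef_VminusB iotaK coef_pole_extend ?subrr // => u.
have /zVplus_pole/(_ j a ma) := wm u.
by rewrite (raddfB pole) /= coef_VminusB iotaK => /eqP; rewrite subr_eq0 => /eqP.
Qed.

Lemma fdet_extend m w : linear w -> congr_id m w ->
  fdet (extend w) = (fdet w)%:A.
Proof.
move=> wL wm; rewrite (fdetE (extend_linear w) (extend_congr_id wm)).
rewrite (fdetE wL wm) /detm -[RHS]/(in_alg R _) -det_map_mx; congr determinant.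
apply/matrixP => i l; rewrite !mxE.
have -> : Fm (delta_mx 0 i) = Vminus_map R (@Fm k n m (delta_mx 0 i)).
  apply/VminusP => j a; rewrite Vminus_map_coef !coef_Fm.
  case: insubP => [b _ _|_]; last by rewrite scale0r.
  by rewrite !mxE; exact/esym/(rmorph_nat (in_alg R)).
rewrite extend_map //; case: (mxvec_indexP l) => a j.
by rewrite !principal_partE VmapE.
Qed.

Lemma range_extend (U : set (Vhat k n)) w : linear w -> range w = U ->
  range (extend w) = @scalar_ext k n R U.
Proof.
move=> wL wU; rewrite eqEsubset; split=> [_ [v _ <-] L Lsub UL|x].
  apply: submodule_sum => // j; apply: submodule_sum => // a.
  by apply: submoduleZ => //; apply: UL; exists (w (Vminus_mono j a)); rewrite -?wU //;
    exists (Vminus_mono j a).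
apply.
  apply/submoduleP; split.
    by exists (0 - 0) => //; rewrite -scaleN1r addrC extend_linear scaleN1r addrC subrr.
  move=> a _ _ [u _ <-] [v _ <-]; exists (a *: u + v) => //.
  exact: extend_linear.
move=> _ [y Uy <-]; move: Uy; rewrite -wU => -[u _ <-]; exists (Vminus_map R u) => //.
exact: extend_map.
Qed.

End BaseChange.

(** * The group action on frames *)

Section FrameAction.
Variables (R : comNzRingType) (n : nat).
Implicit Types (L : set (Vhat R n)) (w : Vminus R n -> Vhat R n).

Lemma zVplus_act (g : Vminus R n) m D x : (forall j, size (g j) <= D)%N ->
  zVplus (- m%:Z) x -> zVplus (- (m + D)%N%:Z) (act g x).
Proof.
move=> gD xm j i im; rewrite actE; apply: big1 => s _.
have sD := leq_trans (ltn_ord s) (gD j); rewrite xm ?mulr0 //.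
by move: (nat_of_ord s) sD => {}s sD; lia.
Qed.

Variables g h : Vminus R n.
Hypothesis hg : act_minus h g = [ffun=> 1].

Let gh : act_minus g h = [ffun=> 1].
Proof. by rewrite act_minusC. Qed.

Lemma congr_id_act m w : congr_id m w ->
  exists m', congr_id m' (fun v => act g (w (act_minus h v))).
Proof.
move=> wm; have [D gD] := Vminus_bound g; exists (m + D)%N => v.
have -> : iota v = act g (iota (act_minus h v)).
  by rewrite act_iota (act_minusK gh).
by rewrite -(raddfB (act g)); apply: zVplus_act gD _; apply: wm.
Qed.

(** [V^-] is stable under [g], so the source of [g w g^-1] is again [V^-]. *)
Lemma frame_act L w : frame L w ->
  frame [set act g x | x in L] (fun v => act g (w (act_minus h v))).
Proof.
move=> [wL wI wr [m wm]]; split.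
- by move=> a u v; rewrite act_minus_is_linear wL act_is_linear.
- by move=> u v /(can_inj (actK hg))/wI/(can_inj (act_minusK gh)).
- rewrite eqEsubset; split=> [_ [v _ <-]|_ [x Lx <-]].
    by exists (w (act_minus h v)) => //; rewrite -wr; exists (act_minus h v).
  move: Lx; rewrite -wr => -[v _ <-]; exists (act_minus g v) => //.
  by rewrite (act_minusK hg).
exact: congr_id_act wm.
Qed.

End FrameAction.

Section FdetAction.
Variables (R : comNzRingType) (n : nat) (g h : Vminus R n).
Hypothesis hg : act_minus h g = [ffun=> 1].
Implicit Types (L : set (Vhat R n)) (w W : Vminus R n -> Vhat R n).

Let gh : act_minus g h = [ffun=> 1].
Proof. by rewrite act_minusC. Qed.

Lemma frame_act_inv L w : frame [set act g x | x in L] w ->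
  frame L (fun v => act h (w (act_minus g v))).
Proof.
move=> /(frame_act gh); congr frame.
rewrite eqEsubset; split=> [_ [_ [x Lx <-] <-]|x Lx].
  by rewrite (actK hg).
by exists (act g x); rewrite ?(actK hg) //; exists x.
Qed.

(** A frame [w] of [gL] is [g W g^-1 \o g T g^-1], where [W \o T] is the frame
    [g^-1 w g] of [L]. *)
Lemma fdet_act L W w : frame L W -> normalized W ->
    frame [set act g x | x in L] w ->
  fdet w = fdet (fun v => act h (w (act_minus g v)))
           * fdet (fun v => act g (W (act_minus h v))).
Proof.
move=> WF WE wF; have w'F := frame_act_inv wF; set w' := fun v => _ in w'F *.
have [PhiL _ _ [m1 Phim]] := frame_act hg WF.
set Phi := fun v => act g (W _) in PhiL Phim *.
have [w'L _ _ [m2 w'm]] := w'F.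
pose T := pole \o w'.
have TL : linear T by move=> a u v; rewrite /T /= w'L pole_is_linear.
have Tm : congr_id m2 (iota \o T).
  move=> v; have /zVplus_pole w'v := w'm v; apply/zVplus_pole => j a ma.
  by have := w'v j a ma; rewrite !(raddfB pole) /= !iotaK.
pose gTh v := act_minus g (T (act_minus h v)).
have gThL : linear gTh.
  by move=> a u v; rewrite /gTh act_minus_is_linear TL act_minus_is_linear.
have gThE : iota \o gTh = fun v => act g (iota (T (act_minus h v))).
  by apply/funext => v; rewrite /= act_iota.
have [m3 gThm] := congr_id_act hg Tm.
have wE : w = Phi \o gTh.
  apply/funext => v; rewrite /= /Phi /gTh (act_minusK hg).
  have := congr1 (fun f => f (act_minus h v)) (frame_factor WF WE w'F).
  by rewrite /= /T /= => <-; rewrite /w' (act_minusK gh) (actK gh).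
pose m := maxn m1 m3.
rewrite {1}wE (@fdet_comp _ _ m) //; first last.
- by rewrite gThE; apply: congr_id_le (leq_maxr _ _) gThm.
- exact: congr_id_le (leq_maxl _ _) Phim.
congr (_ * _); rewrite (fdet_conj hg TL Tm); apply: fdet_pole => //.
- by move=> a u v /=; rewrite TL iota_is_linear.
- by exists m2.
by move=> v; rewrite /= iotaK.
Qed.

End FdetAction.

(** The two sections of [Det^*] over [gU] are compared on the frame
    [g w1 g^-1], where [g . delta] takes the value [delta w1]; by [fdet_act] the
    ratio is the same on all other frames. *)
Lemma tau_valueP (k : fieldType) (n : nat) (U : set (Vhat k n))
    (delta : (Vminus k n -> Vhat k n) -> k) (w1 : Vminus k n -> Vhat k n)
    (R : comAlgType k) (g h : Vminus R n) (a : R) :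
    det_dual U delta -> frame U w1 -> normalized w1 ->
    act_minus h g = [ffun=> 1] ->
  tau_value U delta g h a <->
  fdet (fun v => act g (extend w1 (act_minus h v))) = delta w1 *: a.
Proof.
move=> dU w1F w1E hg; have gh : act_minus g h = [ffun=> 1] by rewrite act_minusC.
have [w1L _ w1r _] := w1F.
have WE := extend_normalized (R := R) w1E.
have WF := normalized_frame (extend_linear w1) WE (range_extend R w1L w1r).
split=> [[dR [dRd dRe] Oa]|Da].
  have PhiF := frame_act hg WF.
  rewrite -[LHS]/(Omega_plus _) Oa // /det_dual_act.
  under [X in dR X]funext do rewrite (actK hg) (act_minusK hg).
  rewrite (dRe w1) ?mulr_algr //; first exact: extend_linear.
  by move=> v; apply: extend_map.
exists (fun w => (delta w1)%:A * fdet w); first split.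
- exact: det_dual_fdet.
- move=> w wR wF wRL wRw; have [wL _ _ [m wm]] := wF.
  rewrite (extend_unique wRL wRw) (fdet_extend R wL wm).
  by rewrite (det_dual_normalized dU w1F w1E wF) mulr_algl scalerA.
move=> w wF; rewrite /Omega_plus (fdet_act hg WF WE wF) Da.
by rewrite /det_dual_act mulr_algl -scalerAr mulrC scalerAr.
Qed.

(** * Division by [h] *)

Section Division.
Variables (R : comNzRingType) (n N : nat).
Variables (W : Vminus R n -> Vhat R n) (g h : Vminus R n).
Hypotheses (WL : linear W) (WE : normalized W).
Hypotheses (hg : act_minus h g = [ffun=> 1]).
Hypotheses (hN : forall j, (size (h j) <= N.+1)%N).
Implicit Types (v : Vminus R n) (u : 'rV[R]_(N * n)).

Let gh : act_minus g h = [ffun=> 1].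
Proof. by rewrite act_minusC. Qed.

Definition regular (x : Vhat R n) := x - iota (pole x).

Lemma regular_linear : linear regular.
Proof.
move=> a x y; rewrite /regular pole_is_linear iota_is_linear scalerBr opprD.
by rewrite !addrA; congr (_ - _); rewrite -!addrA; congr (_ + _); rewrite addrC.
Qed.

Lemma regularE x j i : regular x j i = if (0 <= i)%R then x j i else 0.
Proof.
by case: i => i; rewrite VhatB iotaE /= ?subr0 // coef_pole subrr.
Qed.

Lemma Vplus_regular x : Vplus (regular x).
Proof. by move=> j i i0; rewrite regularE leNgt i0. Qed.

(** The component in [V^+] of the value of a normalized frame. *)
Definition tail v := W v - iota v.

Lemma tail_linear : linear tail.
Proof. exact: linear_sub_iota. Qed.

Lemma Vplus_tail v : Vplus (tail v).
Proof. by apply/Vplus_pole; rewrite (raddfB pole) /= iotaK WE subrr. Qed.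

(** The quotient and (as coordinates) the remainder of the division of [W v] by
    [h]: modulo [h V^+], every element of [z^-N V^+] has a unique representative
    in [F_N]. *)
Definition quotient v := regular (act g (tail v)).
Definition remainder u := u - principal_part N (act h (quotient (Fm u))).

Lemma quotient_linear : linear quotient.
Proof.
by move=> a x y; rewrite /quotient tail_linear act_is_linear regular_linear.
Qed.

Lemma remainder_linear : linear remainder.
Proof.
move=> a x y; rewrite /remainder Fm_is_linear quotient_linear act_is_linear.
rewrite principal_part_is_linear scalerBr opprD.
by rewrite !addrA; congr (_ - _); rewrite -!addrA; congr (_ + _); rewrite addrC.
Qed.

Lemma act_quotient v :
  act h (quotient v) = tail v - iota (act_minus h (pole (act g (tail v)))).
Proof. by rewrite (raddfB (act h)) /= (actK hg) act_iota. Qed.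

Lemma pole_act_quotient v :
  pole (act h (quotient v)) = - act_minus h (pole (act g (tail v))).
Proof.
rewrite act_quotient (raddfB pole) /= iotaK.
by rewrite ((Vplus_pole (tail v)).1 (Vplus_tail v)) sub0r.
Qed.

Lemma Fm_act_quotient v :
  Fm (principal_part N (act h (quotient v))) = pole (act h (quotient v)).
Proof.
apply: Fm_principal_part; apply/zVplus_pole => j a Na.
by rewrite (pole_act_Vplus j hN) //; apply: Vplus_regular.
Qed.

(** Weierstrass division of [z^N W v] by the polynomial [z^N h] of [z], for [v] in
    [F_N]. The inverse [g] of [h] is a polynomial in [z^-1], so the quotient is
    given by a formula and no successive approximation is involved. *)
Lemma division u :
  W (Fm u) = iota (Fm (remainder u)) + act h (quotient (Fm u)).
Proof.
rewrite (raddfB (@Fm R n N)) /= Fm_act_quotient pole_act_quotient opprK.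
rewrite (raddfD iota) /= act_quotient addrACA subrr addr0.
by rewrite /tail addrC subrK.
Qed.

(** The map [g W h] of [V^-] is the identity plus [pole \o g \o tail \o h],
    and [pole (g x) = - g (pole (h (regular (g x))))] for [x] in [V^+]: this
    factors through [F_N], and exchanging the factors gives the remainder. *)
Lemma fdet_remainder :
  fdet (fun v => act g (W (act_minus h v))) = \det (lin1_mx remainder).
Proof.
pose alpha v := - principal_part N (act h (quotient (act_minus h v))).
pose beta u := act_minus g (@Fm R n N u).
have aL : linear alpha.
  move=> a x y; rewrite /alpha act_minus_is_linear quotient_linear act_is_linear.
  by rewrite principal_part_is_linear opprD scalerN.
have bL : linear beta.
  by move=> a x y; rewrite /beta Fm_is_linear act_minus_is_linear.
have PhiL : linear (fun v => act g (W (act_minus h v))).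
  by move=> a x y; rewrite act_minus_is_linear WL act_is_linear.
rewrite (fdet_finite_rank PhiL aL bL) => [|v].
  congr determinant; apply: eq_mx_rV => u.
  have abL : linear (fun u => alpha (beta u)) by move=> a x y; rewrite bL aL.
  rewrite mulmxDr mulmx1 (mul_rV_lin1_linear _ abL).
  rewrite (mul_rV_lin1_linear _ remainder_linear).
  by rewrite /alpha /beta (act_minusK hg).
rewrite /beta /alpha (raddfN (@Fm R n N)) /= Fm_act_quotient pole_act_quotient.
rewrite opprK (act_minusK gh).
have -> : W (act_minus h v) = iota (act_minus h v) + tail (act_minus h v).
  by rewrite /tail addrC subrK.
by rewrite (raddfD (act g)) /= act_iota (act_minusK gh) (raddfD pole) /= iotaK.
Qed.

End Division.

(** * Block Vandermonde determinants *)

Section Reindexing.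
Variables (m n : nat).

Definition unindex (p : 'I_(m * n)) : 'I_m * 'I_n :=
  enum_val (cast_ord (esym (mxvec_cast m n)) p).

Lemma mxvec_indexK i j : unindex (mxvec_index i j) = (i, j).
Proof. by rewrite /unindex cast_ordK enum_rankK. Qed.

Lemma sum_mxvec_index (V : nmodType) (F : 'I_(m * n) -> V) :
  \sum_p F p = \sum_i \sum_j F (mxvec_index i j).
Proof.
rewrite pair_big_dep /=.
by rewrite (reindex _ (curry_mxvec_bij m n)) /=; apply: eq_bigr => -[].
Qed.

End Reindexing.

Section BlockDiagonal.
Variables (R : comNzRingType) (n N : nat).
Implicit Types B : 'I_n -> 'M[R]_N.

Definition block_diag B : 'M[R]_(n * N) :=
  \matrix_(p, q) if (unindex p).1 == (unindex q).1
                 then B (unindex p).1 (unindex p).2 (unindex q).2 else 0.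

Lemma block_diagE B j a j' i :
  block_diag B (mxvec_index j a) (mxvec_index j' i) = B j a i *+ (j == j').
Proof. by rewrite mxE !mxvec_indexK /=; case: eqP. Qed.

Lemma mxvec_matrixP (A B : 'M[R]_(n * N)) :
  (forall j a j' i, A (mxvec_index j a) (mxvec_index j' i)
                  = B (mxvec_index j a) (mxvec_index j' i)) -> A = B.
Proof.
move=> AB; apply/matrixP => p q.
by case: (mxvec_indexP p) => j a; case: (mxvec_indexP q) => j' i.
Qed.

Lemma block_diag1 : block_diag (fun=> 1%:M) = 1%:M.
Proof.
apply: mxvec_matrixP => j a j' i; rewrite block_diagE !mxE.
rewrite -mulrnA mulnb; congr (_ *+ nat_of_bool _).
apply/andP/eqP => [[/eqP -> /eqP ->] //|].
by move=> /(congr1 (@unindex n N)); rewrite !mxvec_indexK => -[-> ->].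
Qed.

Lemma block_diagM B B' :
  block_diag B *m block_diag B' = block_diag (fun j => B j *m B' j).
Proof.
apply: mxvec_matrixP => j a j' i; rewrite block_diagE !mxE sum_mxvec_index.
rewrite (bigD1 j) //= [X in _ + X]big1 ?addr0.
  rewrite -sumrMnl; apply: eq_bigr => l _.
  by rewrite !block_diagE eqxx mulr1n mulrnAr.
move=> j1 jj1; rewrite big1 // => l _.
by rewrite block_diagE eq_sym (negbTE jj1) mul0r.
Qed.

(** A single nontrivial block is a perturbation of the identity which factors
    through the coordinates of that block. *)
Lemma det_block_diag_single j0 (A : 'M[R]_N) :
  \det (block_diag (fun j => if j == j0 then A else 1%:M)) = \det A.
Proof.
pose X : 'M[R]_(n * N, N) := \matrix_(p, i)
  if (unindex p).1 == j0 then (A - 1%:M) (unindex p).2 i else 0.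
pose Y : 'M[R]_(N, n * N) := \matrix_(i, q)
  if (unindex q).1 == j0 then (i == (unindex q).2)%:R else 0.
have -> : block_diag (fun j => if j == j0 then A else 1%:M) = 1%:M + X *m Y.
  rewrite -block_diag1; apply: mxvec_matrixP => j a j' i.
  rewrite block_diagE [RHS]mxE block_diagE [X in _ = _ + X]mxE.
  under eq_bigr do rewrite !mxE !mxvec_indexK /=.
  have [-> | jj0] := eqVneq j j0; last by rewrite big1 ?addr0 // => l _; rewrite mul0r.
  have [jj0 | jj0] := eqVneq j' j0; last first.
    by rewrite big1 ?addr0 // => l _; rewrite mulr0.
  subst j'; rewrite (bigD1 i) //= !eqxx mulr1 big1 ?addr0.
    by rewrite !mulr1n [in RHS]mxE addrCA subrr addr0.
  by move=> l /negbTE ->; rewrite mulr0.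
rewrite det_addmulC; congr determinant.
have -> : Y *m X = A - 1%:M; last by rewrite addrC subrK.
apply/matrixP => a i; rewrite mxE sum_mxvec_index (bigD1 j0) //=.
rewrite [X in _ + X]big1 ?addr0.
  rewrite (bigD1 a) //= big1 ?addr0.
    by rewrite !mxE !mxvec_indexK /= !eqxx mul1r.
  by move=> l la; rewrite !mxE !mxvec_indexK /= !eqxx eq_sym (negbTE la) mul0r.
by move=> j jj0; rewrite big1 // => l _; rewrite !mxE !mxvec_indexK /= (negbTE jj0) mul0r.
Qed.

Lemma det_block_diag B : \det (block_diag B) = \prod_j \det (B j).
Proof.
suff D s : uniq s -> \det (block_diag (fun j => if j \in s then B j else 1%:M))
    = \prod_(j <- s) \det (B j).
  rewrite -big_enum -D ?enum_uniq //; congr (\det (block_diag _)).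
  by apply/funext => j; rewrite mem_enum.
elim: s => [_|j s IHs /= /andP[js us]]; first by rewrite big_nil block_diag1 det1.
rewrite big_cons -IHs // -(det_block_diag_single j) -det_mulmx block_diagM.
congr (\det (block_diag _)); apply/funext => j'; rewrite in_cons.
have [->|] := eqVneq; first by rewrite (negbTE js) mulmx1.
by rewrite mul1mx.
Qed.

(** The columns of the interpolation matrix are grouped by component and its
    factorization goes through [F_N], whose coordinates are grouped by order of
    pole; the pole of order [a + 1] corresponds to the exponent [N - 1 - a]. *)
Definition pole_index (q : 'I_(n * N)) : 'I_(N * n) :=
  mxvec_index (rev_ord (unindex q).2) (unindex q).1.

Lemma pole_index_bij : bijective pole_index.
Proof.
exists (fun p => mxvec_index (unindex p).2 (rev_ord (unindex p).1)) => p.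
  by rewrite /pole_index; case: (mxvec_indexP p) => j a;
    rewrite !mxvec_indexK /= rev_ordK.
by rewrite /pole_index; case: (mxvec_indexP p) => j a;
  rewrite !mxvec_indexK /= rev_ordK.
Qed.

(** Right multiplication by this matrix maps the coordinates of [q] in [F_N] to
    the values of the polynomials [z^N q_j] at the points [t_ij]. *)
Definition eval_mx (t : 'I_(n * N) -> R) : 'M[R]_(N * n, n * N) :=
  \matrix_(p, q) (t q ^+ (N - (unindex p).1.+1) *+
                    ((unindex p).2 == (unindex q).1)).

Lemma det_eval_mx t : \det (mxsub pole_index id (eval_mx t))
  = \prod_(j < n) \prod_(i < N) \prod_(l < N | (i < l)%N)
      (t (tidx l j) - t (tidx i j)).
Proof.
pose B j := Vandermonde N (\row_i t (tidx i j)).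
have -> : mxsub pole_index id (eval_mx t) = block_diag B.
  apply: mxvec_matrixP => j a j' i; rewrite block_diagE !mxE !mxvec_indexK /=.
  have [<-|_] := eqVneq j j'; last by rewrite mulr0n.
  rewrite !mulr1n; congr (_ ^+ _); case: a => a aN /=; lia.
rewrite det_block_diag; apply: eq_bigr => j _; rewrite det_Vandermonde.
by apply: eq_bigr => i _; apply: eq_bigr => l _; rewrite !mxE.
Qed.

Lemma det_interpolation (C : 'M[R]_(n * N, N * n)) (A : 'M[R]_(N * n)) t :
  \det (C *m A *m eval_mx t) = \det (colsub pole_index C) * \det A
    * \prod_(j < n) \prod_(i < N) \prod_(l < N | (i < l)%N)
        (t (tidx l j) - t (tidx i j)).
Proof.
rewrite -det_eval_mx -(det_mxsub_bij A pole_index_bij) -!det_mulmx.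
congr determinant; rewrite (mulmx_reindex _ _ pole_index_bij); congr (_ *m _).
rewrite (mulmx_reindex C A pole_index_bij); apply/matrixP => i j; rewrite !mxE.
by apply: eq_bigr => l _; rewrite !mxE.
Qed.

End BlockDiagonal.

(** * Evaluation of power series *)

Section Evaluation.
Variables (p : nat) (k : comNzRingType).
Implicit Types (f g : mps p k) (P Q : {mpoly k[p]}) (m : 'X_{1..p}).

Lemma mpsM f g m : (f * g) m =
  \sum_(l : 'X_{1..p < (mdeg m).+1, (mdeg m).+1} | m == (l.1 + l.2)%MM)
    f l.1 * g l.2.
Proof. by []. Qed.

Lemma mps_mpolyM b f g P Q m : (mdeg m < b)%N ->
  (forall l, (mdeg l < b)%N -> f l = P@_l) ->
  (forall l, (mdeg l < b)%N -> g l = Q@_l) -> (f * g) m = (P * Q)@_m.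
Proof.
move=> mb fP gQ; rewrite mpsM mcoeffM; apply: eq_bigr => -[l1 l2] /= _.
by rewrite fP ?gQ // (leq_trans (bmdeg _)).
Qed.

Definition mps_trunc b f : {mpoly k[p]} := \sum_(m : 'X_{1..p < b}) f m *: 'X_[m].

Lemma coef_mps_trunc b f m : (mdeg m < b)%N -> (mps_trunc b f)@_m = f m.
Proof. exact: mcoeff_mpoly. Qed.

Section FormalPoint.
Variables (R : comAlgType k) (b : nat) (t : 'I_p -> R).
Hypothesis tb : formal_point b t.

Local Notation mmapR := (mmap (in_alg R) t).

(** At a formal point a power series may be replaced by any polynomial with the
    same coefficients in degree less than [b]. *)
Lemma mps_eval_mpoly f P : (forall m, (mdeg m < b)%N -> f m = P@_m) ->
  mps_eval b t f = mmapR P.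
Proof.
move=> fP; have -> : mps_eval b t f = mmapR (mps_trunc b f).
  rewrite raddf_sum; apply: eq_bigr => m _.
  by rewrite /= mmapZ mmapX mulr_algl.
apply/eqP; rewrite -subr_eq0 -raddfB /=; apply/eqP.
rewrite /mmap big1 // => m _; case: (ltnP (mdeg m) b) => mb; last first.
  by rewrite tb // mulr0.
by rewrite mcoeffB coef_mps_trunc // fP // subrr rmorph0 mul0r.
Qed.

Lemma mps_eval_trunc f : mps_eval b t f = mmapR (mps_trunc b f).
Proof. by apply: mps_eval_mpoly => m mb; rewrite coef_mps_trunc. Qed.

(** Evaluation at a formal point depends only on truncations, where it is the
    evaluation of polynomials. *)
Lemma mps_eval_rmorphism :
  exists phi : {rmorphism mps p k -> R}, forall f, phi f = mps_eval b t f.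
Proof.
have A : zmod_morphism (mps_eval b t : mps p k -> R).
  move=> f g; rewrite -sumrB; apply: eq_bigr => m _.
  by rewrite -scalerBl.
have M : monoid_morphism (mps_eval b t : mps p k -> R).
  split=> [|f g].
    rewrite (@mps_eval_mpoly _ 1) ?rmorph1 // => m _.
    by rewrite mcoeff1.
  rewrite (@mps_eval_mpoly _ (mps_trunc b f * mps_trunc b g)).
    by rewrite rmorphM !mps_eval_trunc.
  by move=> m mb; apply: (mps_mpolyM mb) => l lb; rewrite coef_mps_trunc.
pose phi : {rmorphism mps p k -> R} := HB.pack (mps_eval b t : mps p k -> R)
  (GRing.isZmodMorphism.Build _ _ _ A) (GRing.isMonoidMorphism.Build _ _ _ M).
by exists phi.
Qed.

Lemma mps_evalZ c f : mps_eval b t (c *: f) = c *: mps_eval b t f.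
Proof. by rewrite scaler_sumr; apply: eq_bigr => m _; rewrite scalerA. Qed.

Lemma mps_eval_var i : mps_eval b t (mps_var k i) = t i.
Proof.
rewrite (@mps_eval_mpoly _ 'X_i) ?mmapX ?mmap1U // => m _.
by rewrite mcoeffX eq_sym.
Qed.

Lemma formal_point_expr i l : (b <= l)%N -> t i ^+ l = 0.
Proof.
move=> bl; have := tb (m := (U_(i) *+ l)%MM).
rewrite mdegMn mdeg1 mul1n => /(_ bl) <-.
by rewrite -(mmapX t (in_alg R)) -mpolyXn rmorphXn /= mmapX mmap1U.
Qed.

Lemma mps_eval_subst i (x : laurent k) B : (b <= B)%N ->
  mps_eval b t (laurent_subst i x) = \sum_(l < B) x l%:Z *: t i ^+ l.
Proof.
move=> bB; rewrite (@mps_eval_mpoly _ (\sum_(l < B) x l%:Z *: 'X_i ^+ l)).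
  rewrite raddf_sum; apply: eq_bigr => l _.
  by rewrite /= mmapZ rmorphXn /= mmapX mmap1U mulr_algl.
move=> m mb; rewrite raddf_sum /=.
have [mE|mE] := eqVneq m _; last first.
  rewrite big1 // => l _; rewrite mcoeffZ mcoeffXn; case: eqP => [E|]; last first.
    by rewrite mulr0.
  by case/eqP: mE; rewrite -E mulmnE mnm1E eqxx mul1n.
have mB : (m i < B)%N.
  by rewrite (leq_trans _ bB) // (leq_trans _ mb) // mdegE (bigD1 i) //= leq_addr.
rewrite (bigD1 (Ordinal mB)) //= big1 ?addr0 => [|l lm].
  by rewrite mcoeffZ mcoeffXn -mE eqxx mulr1.
rewrite mcoeffZ mcoeffXn; case: eqP => [E|]; last by rewrite mulr0.
case/eqP: lm; apply: val_inj => /=.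
by rewrite -E mulmnE mnm1E eqxx mul1n.
Qed.

End FormalPoint.

End Evaluation.

(** * Truncated power series *)

(** The ring [k[[X]]/(X)^(b+1)]: the values of a power series at the formal
    points of these rings determine it. *)
Section TruncatedPowerSeries.
Variables (p b : nat) (k : comNzRingType).

Definition tps := {ffun 'X_{1..p < b.+1} -> k^o}.
HB.instance Definition _ := GRing.Lmodule.on tps.

Implicit Types (x y z : tps) (f g : mps p k).

Definition tps_of f : tps := [ffun m : 'X_{1..p < b.+1} => f m].

Definition tps_val x : mps p k :=
  @MPS p k (fun m => if insub m is Some l then x l else 0).

Lemma tps_valK : cancel tps_val tps_of.
Proof. by move=> x; apply/ffunP => m; rewrite ffunE /= valK. Qed.

Lemma tps_ofP f g :
  tps_of f = tps_of g <-> forall m, (mdeg m <= b)%N -> f m = g m.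
Proof.
split=> [/ffunP fg m mb|fg]; last by apply/ffunP => -[m mb]; rewrite !ffunE fg.
by have := fg (BMultinom (mb : (mdeg m < b.+1)%N)); rewrite !ffunE.
Qed.

Definition tps_mul x y : tps := tps_of (tps_val x * tps_val y).

Lemma tps_ofM f g : tps_of (f * g) = tps_mul (tps_of f) (tps_of g).
Proof.
have E (h : mps p k) l : (mdeg l <= b)%N -> h l = tps_val (tps_of h) l.
  by move=> lb; apply/esym; move: l lb; apply/tps_ofP; rewrite tps_valK.
apply/tps_ofP => m mb; rewrite !mpsM; apply: eq_bigr => -[l1 l2] _.
have lb (l : 'X_{1..p < (mdeg m).+1}) : (mdeg l <= b)%N.
  by rewrite (leq_trans _ mb) // -ltnS bmdeg.
by congr (_ * _); apply: E; apply: lb.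
Qed.

Lemma tps_of_surj x : exists f, x = tps_of f.
Proof. by exists (tps_val x); rewrite tps_valK. Qed.

Fact tps_mulA : associative tps_mul.
Proof.
move=> x y z; have [[f ->] [g ->]] := (tps_of_surj x, tps_of_surj y).
by have [h ->] := tps_of_surj z; rewrite -!tps_ofM mulrA.
Qed.

Fact tps_mulC : commutative tps_mul.
Proof.
move=> x y; have [[f ->] [g ->]] := (tps_of_surj x, tps_of_surj y).
by rewrite -!tps_ofM mulrC.
Qed.

Fact tps_mul1 : left_id (tps_of 1) tps_mul.
Proof. by move=> x; have [f ->] := tps_of_surj x; rewrite -tps_ofM mul1r. Qed.

Lemma tps_ofD f g : tps_of (f + g) = tps_of f + tps_of g.
Proof. by apply/ffunP => m; rewrite !ffunE. Qed.

Fact tps_mulDl : left_distributive tps_mul +%R.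
Proof.
move=> x y z; have [[f ->] [g ->]] := (tps_of_surj x, tps_of_surj y).
by have [h ->] := tps_of_surj z; rewrite -tps_ofD -!tps_ofM mulrDl tps_ofD.
Qed.

Fact tps_oner_neq0 : tps_of 1 != 0.
Proof.
have b0 : (mdeg (0%MM : 'X_{1..p}) < b.+1)%N by rewrite mdeg0.
apply/eqP => /ffunP/(_ (BMultinom b0)); rewrite !ffunE /= eqxx.
by move/eqP; rewrite oner_eq0.
Qed.

Lemma tps_ofZ a f : tps_of (a *: f) = a *: tps_of f.
Proof. by apply/ffunP => m; rewrite !ffunE. Qed.

Fact tps_scaleAl (a : k) x y : a *: tps_mul x y = tps_mul (a *: x) y.
Proof.
have [[f ->] [g ->]] := (tps_of_surj x, tps_of_surj y).
rewrite -tps_ofM -!tps_ofZ -tps_ofM; congr tps_of; apply/mpsP => m.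
by rewrite mpsM [LHS]mulr_sumr; apply: eq_bigr => l _; exact: mulrA.
Qed.

HB.instance Definition _ := GRing.Zmodule_isComNzRing.Build tps
  tps_mulA tps_mulC tps_mul1 tps_mulDl tps_oner_neq0.

HB.instance Definition _ := GRing.Lmodule_isLalgebra.Build k tps tps_scaleAl.
HB.instance Definition _ := GRing.Lalgebra_isComAlgebra.Build k tps.

Definition tps_var i : tps := tps_of (mps_var k i).

Lemma mmap1_tps_var m : mmap1 tps_var m = tps_of (MPS (fun l => (m == l)%:R)).
Proof.
pose theta (P : {mpoly k[p]}) := tps_of (MPS (fun m => P@_m)).
have thetaM P Q : theta (P * Q) = theta P * theta Q.
  apply: etrans (tps_ofM _ _); congr tps_of; apply/mpsP => l.
  by rewrite mpsM -mcoeffM.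
have theta1 : theta 1 = 1.
  by congr tps_of; apply/mpsP => l; rewrite /= mcoeff1.
have -> : MPS (fun l => (m == l)%:R) = MPS (fun l => 'X_[k, m]@_l).
  by apply/mpsP => l; rewrite /= mcoeffX.
rewrite -/(theta _) mpolyXE_id (big_morph theta thetaM theta1) /mmap1.
apply: eq_bigr => i _; elim: (m i) => [|e IHe]; first by rewrite !expr0 theta1.
rewrite !exprS thetaM IHe; congr (_ * _); congr tps_of; apply/mpsP => l.
by rewrite /= mcoeffX eq_sym.
Qed.

Lemma formal_point_tps_var : formal_point b.+1 tps_var.
Proof.
move=> m bm; rewrite mmap1_tps_var; apply/ffunP => -[l lb]; rewrite !ffunE /=.
by case: eqP => // E; rewrite E leqNgt lb in bm.
Qed.

Lemma mps_eval_tps_var f : mps_eval b.+1 tps_var f = tps_of f.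
Proof.
apply/ffunP => l; rewrite /mps_eval sum_ffunE ffunE (bigD1 l) //= big1 ?addr0.
  by rewrite mmap1_tps_var !ffunE /= eqxx; apply: mulr1.
move=> m ml; rewrite mmap1_tps_var !ffunE /=; rewrite -bmeqP (negbTE ml).
exact: mulr0.
Qed.

End TruncatedPowerSeries.

(** The tautological point of [k[[X]]/(X)^(b+1)] evaluates a power series to its
    own truncation. *)
Lemma mps_eval_inj (p : nat) (k : comNzRingType) (f g : mps p k) :
  (forall (R : comAlgType k) (b : nat) (t : 'I_p -> R),
     formal_point b t -> mps_eval b t f = mps_eval b t g) -> f = g.
Proof.
move=> fg; apply/mpsP => m.
have := fg (tps p (mdeg m) k) _ _ (@formal_point_tps_var _ _ _).
by rewrite !mps_eval_tps_var => /tps_ofP; apply.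
Qed.

(** * The determinant as a power series *)

Section GeometricSeries.
Variables (p : nat) (k : comNzRingType).
Implicit Types (P : pred 'I_p) (x : int -> k) (l : int) (m : 'X_{1..p}).

Definition supported P m := [forall i, (m i != 0%N) ==> P i].

(** The coefficient of [z^l] in the product of [x] by the geometric series
    [(1 - t_i / z)^-1] for [i] in [P]: each monomial occurs in it once. *)
Definition geometric P x l : mps p k :=
  MPS (fun m => if supported P m then x (l + (mdeg m)%:Z) else 0).

Lemma eq_geometric P Q x l : P =1 Q -> geometric P x l = geometric Q x l.
Proof. by move=> /funext ->. Qed.

Lemma mps_varM i (f : mps p k) m :
  (mps_var k i * f) m = if m i == 0%N then 0 else f (m - U_(i))%MM.
Proof.
rewrite mpsM; have [mi|mi] := eqVneq (m i) 0%N.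
  apply: big1 => -[l1 l2] /= /eqP mE; case: eqP => [lE|]; last by rewrite mul0r.
  have := congr1 (fun m' : 'X_{1..p} => m' i) mE.
  by rewrite mi mnmDE lE mnm1E eqxx.
have leU : (U_(i) <= m)%MM.
  by apply/mnm_lepP => j; rewrite mnm1E; case: eqP => // <-; rewrite lt0n.
have mU : (mdeg (U_(i)%MM : 'X_{1..p}) < (mdeg m).+1)%N.
  by rewrite mdeg1 ltnS lt0n mdeg_eq0; apply: contraNneq mi => ->; rewrite mnm0E.
have mB : (mdeg (m - U_(i))%MM < (mdeg m).+1)%N by rewrite ltnS mdegB.
rewrite (bigD1 (BMultinom mU, BMultinom mB)) /=; last first.
  by rewrite addmC submK.
rewrite eqxx mul1r big1 ?addr0 // => -[l1 l2] /= /andP[/eqP mE].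
rewrite xpair_eqE !bmeqP /=; case: (eqVneq (bmnm l1)) => [lE|]; last by rewrite mul0r.
have -> : (m - U_(i))%MM = l2.
  have := congr1 (fun m' => m' - U_(i))%MM mE.
  by rewrite lE addmC addmK.
by rewrite eqxx.
Qed.

Lemma geometric_step P i x l : ~~ P i ->
  geometric (predU1 i P) x l - mps_var k i * geometric (predU1 i P) x (l + 1)
  = geometric P x l.
Proof.
move=> Pi; apply/mpsP => m.
rewrite -[LHS]/(geometric _ x l m - (mps_var k i * geometric _ x (l + 1)) m).
rewrite mps_varM /=; have [mi|mi] := eqVneq (m i) 0%N.
  rewrite subr0; congr (if _ then _ else _).
  apply: eq_forallb => j /=; have [->|//] := eqVneq j i.
  by rewrite mi eqxx.
have -> : supported P m = false.
  by apply/negbTE/forallPn; exists i; rewrite negb_imply mi.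
have mU : (U_(i) <= m)%MM.
  by apply/mnm_lepP => j; rewrite mnm1E; case: eqP => // <-; rewrite lt0n.
have -> : supported (predU1 i P) (m - U_(i))%MM = supported (predU1 i P) m.
  apply: eq_forallb => j /=; have [->|ji] := eqVneq j i; first by rewrite !implybT.
  by rewrite mnmBE mnm1E [i == j]eq_sym (negbTE ji) subn0.
have -> : l + 1 + (mdeg (m - U_(i))%MM)%:Z = l + (mdeg m)%:Z.
  have -> : mdeg m = (mdeg (m - U_(i))%MM).+1.
    by rewrite -{1}(submK mU) mdegD mdeg1 addn1.
  by rewrite -addrA.
by rewrite subrr.
Qed.

Lemma geometric0 x l : geometric pred0 x l = x l *: (1 : mps p k).
Proof.
apply/mpsP => m; rewrite -[RHS]/(x l * (m == 0%MM)%:R) /=.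
have -> : supported pred0 m = (m == 0%MM).
  apply/forallP/eqP => [m0|-> i]; last by rewrite mnm0E.
  by apply/mnmP => i; have := m0 i; rewrite implybF negbK mnm0E => /eqP.
by case: eqP => [->|_]; rewrite ?mdeg0 ?addr0 ?mulr1 ?mulr0.
Qed.

(** The identity [(1 - t_i / z) (1 - t_i / z)^-1 = 1], one variable at a time. *)
Lemma shift_act_geometric (s : seq 'I_p) x l : uniq s ->
  shift_act (\prod_(i <- s) (1 - mps_var k i *: 'X)) (geometric (fun i => i \in s) x) l
  = x l *: (1 : mps p k).
Proof.
elim: s l => [|i s IHs] l /=.
  move=> _; rewrite big_nil shift_act1 -geometric0.
  exact: eq_geometric.
move=> /andP[si us]; rewrite big_cons mulrC shift_actM -(IHs l us).
apply: eq_shift_act => r; rewrite shift_act_linear -(geometric_step x r si).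
by congr (_ - _ * _); apply: eq_geometric => j; rewrite /= in_cons.
Qed.

End GeometricSeries.

Lemma rmorph_shift_act (S R : comNzRingType) (phi : {rmorphism S -> R})
    (q : {poly S}) (x : int -> S) l :
  phi (shift_act q x l) = shift_act (map_poly phi q) (phi \o x) l.
Proof.
rewrite (@shift_actE _ (size q) (map_poly phi q)) ?size_poly // rmorph_sum.
by apply: eq_bigr => s _; rewrite /= rmorphM coef_map.
Qed.

Lemma mu_invE (R : comNzRingType) n N (t : 'I_(n * N) -> R) j :
  mu_inv t j = \prod_(i < N) (1 - t (tidx i j) *: 'X).
Proof. by rewrite ffunE. Qed.

Lemma map_mu_inv (S R : comNzRingType) (phi : {rmorphism S -> R}) n N
    (t : 'I_(n * N) -> S) j :
  map_poly phi (mu_inv t j) = mu_inv (phi \o t) j.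
Proof.
rewrite !mu_invE rmorph_prod; apply: eq_bigr => i _.
by rewrite rmorphB rmorph1 /= map_polyZ map_polyX.
Qed.

Lemma size_prod_linear (R : comNzRingType) (I : finType) (P : pred I) (c : I -> R) :
  (size (\prod_(i | P i) (1 - c i *: 'X))%R <= #|P|.+1)%N.
Proof.
have F i : (size (1 - c i *: 'X)%R <= 2)%N.
  rewrite (leq_trans (size_polyD _ _)) // geq_max size_poly1 size_polyN /=.
  by rewrite (leq_trans (size_scale_leq _ _)) // size_polyX.
apply: leq_trans (size_poly_prod_leq _ _) _.
rewrite leq_subLR addnS ltnS addnn -muln2.
apply: (@leq_trans (\sum_(i | P i) 2)); first by apply: leq_sum => i _; apply: F.
by rewrite sum_nat_const.
Qed.

Lemma size_mu_inv (R : comNzRingType) n N (t : 'I_(n * N) -> R) j :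
  (size (mu_inv t j) <= N.+1)%N.
Proof. by rewrite mu_invE (leq_trans (size_prod_linear _ _)) // card_ord. Qed.

Section UniversalRemainder.
Variables (k : fieldType) (n N : nat) (w : Vminus k n -> Vhat k n).

Definition block (j : 'I_n) : seq 'I_(n * N) := [seq tidx i j | i <- enum 'I_N].

(** The matrix of [remainder] over the ring of power series. The series [g x] is
    not a Laurent series there, because its poles are unbounded; only its
    coefficients of nonnegative index enter, and these are [geometric]. *)
Definition universal_remainder : 'M[mps (n * N) k]_(N * n) :=
  \matrix_(p, q) ((p == q)%:R -
    shift_act (mu_inv (@mps_var (n * N) k) (unindex q).2)
      (fun l => if 0 <= l then geometric (fun i => i \in block (unindex q).2)
         (tail w (Fm (delta_mx 0 p)) (unindex q).2) l else 0)
      (Negz (unindex q).1)).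

Lemma uniq_block j : uniq (block j).
Proof.
rewrite map_inj_uniq ?enum_uniq // => i i'.
by move=> /(congr1 (@unindex _ _)); rewrite !mxvec_indexK => -[].
Qed.

Section AtPoint.
Variables (R : comAlgType k) (b : nat) (t : 'I_(n * N) -> R) (g : Vminus R n).
Hypothesis tb : formal_point b t.
Hypothesis hg : act_minus (mu_inv t) g = [ffun=> 1].
Variable phi : {rmorphism mps (n * N) k -> R}.
Hypothesis phiE : forall f, phi f = mps_eval b t f.

Let phi_var : phi \o @mps_var (n * N) k = t.
Proof. by apply/funext => i; rewrite /= phiE mps_eval_var. Qed.

Let phiZ c f : phi (c *: f) = c *: phi f.
Proof. by rewrite !phiE mps_evalZ. Qed.

(** Both sides are solutions [y] of the equation [h y = x], and [h] is
    invertible. *)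
Lemma geometric_eval (x : Vhat k n) j l :
  phi (geometric (fun i => i \in block j) (x j) l) = act g (Vmap R x) j l.
Proof.
pose y l := phi (geometric (fun i => i \in block j) (x j) l).
have hy i : shift_act (mu_inv t j) y i = (x j i)%:A.
  rewrite -phi_var -map_mu_inv -rmorph_shift_act mu_invE.
  have := shift_act_geometric (x j) i (uniq_block j).
  by rewrite big_map big_enum /= => ->; rewrite phiZ rmorph1.
have gh : g j * mu_inv t j = 1.
  by have /ffunP/(_ j) := hg; rewrite !ffunE mulrC.
apply: etrans (esym (shift_act1 y l)) _.
rewrite actE -gh shift_actM; apply: eq_shift_act => i.
by rewrite hy VmapE.
Qed.

Lemma Fm_map m (u : 'rV[k]_(m * n)) :
  Fm (map_mx (in_alg R) u) = Vminus_map R (Fm u).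
Proof.
apply/VminusP => j a; rewrite Vminus_map_coef !coef_Fm.
by case: insubP => [c _ _|_]; rewrite ?scale0r // mxE.
Qed.

Lemma iota_map (v : Vminus k n) : iota (Vminus_map R v) = Vmap R (iota v).
Proof.
apply/VhatP => j i; rewrite VmapE !iotaE; case: i => i; first by rewrite scale0r.
exact: Vminus_map_coef.
Qed.

Lemma universal_remainder_eval : linear w ->
  map_mx phi universal_remainder
  = lin1_mx (remainder (N := N) (extend w) g (mu_inv t)).
Proof.
move=> wL; apply/matrixP => p q; rewrite !mxE rmorphB rmorph_nat.
rewrite rmorph_shift_act map_mu_inv phi_var.
case: (mxvec_indexP q) => a j; rewrite mxvec_indexK /=.
rewrite principal_partE eq_sym; congr (_ - _); rewrite actE; apply: eq_shift_act => l /=.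
rewrite regularE (fun_if phi) rmorph0 geometric_eval; case: ifP => // _.
have -> : delta_mx 0 p = map_mx (in_alg R) (delta_mx 0 p : 'rV[k]_(N * n)).
  by rewrite map_delta_mx.
rewrite /tail Fm_map extend_map // iota_map; congr (act g _ j l).
by apply/VhatP => j' i'; rewrite VmapE !VhatB !VmapE scalerBl.
Qed.

End AtPoint.

End UniversalRemainder.

(** * Evaluation of the interpolation matrix *)

Section Vanishing.
Variables (R : comNzRingType) (n N : nat) (t : 'I_(n * N) -> R).

Lemma sum_telescope_shift (z : int -> R) c r B :
  \sum_(l < B) (z (l%:Z + r) - c * z (l%:Z + r + 1)) * c ^+ l
  = z r - c ^+ B * z (B%:Z + r).
Proof.
elim: B => [|B IHB]; first by rewrite big_ord0 mul1r add0r subrr.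
rewrite big_ord_recr /= IHB mulrBl [z _ * _]mulrC addrA subrK exprSr.
have -> : B%:Z + r + 1 = B.+1%:Z + r by lia.
by rewrite mulrAC [c * _]mulrC.
Qed.

(** The series [z^N h y] is divisible by [z - t_ij], hence vanishes there. *)
Lemma eval_act_mu_inv (y : Vhat R n) i j B : Vplus y ->
    t (tidx i j) ^+ B = 0 ->
  \sum_(l < B) act (mu_inv t) y j (l%:Z - N%:Z) * t (tidx i j) ^+ l = 0.
Proof.
move=> yV tB.
pose q : {poly R} := \prod_(i' < N | i' != i) (1 - t (tidx i' j) *: 'X).
have hE : mu_inv t j = (1 - t (tidx i j) *: 'X) * q by rewrite mu_invE (bigD1 i).
have qN : (size q <= N)%N.
  apply: leq_trans (size_prod_linear _ _) _.
  have N0 : (0 < N)%N := leq_ltn_trans (leq0n i) (ltn_ord i).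
  by rewrite cardC1 card_ord prednK.
pose z := shift_act q (y j).
transitivity (\sum_(l < B) (z (l%:Z - N%:Z) - t (tidx i j) * z (l%:Z - N%:Z + 1))
    * t (tidx i j) ^+ l).
  apply: eq_bigr => l _; congr (_ * _).
  by rewrite actE hE shift_actM shift_act_linear.
rewrite sum_telescope_shift tB mul0r subr0; apply: big1 => s _.
rewrite yV ?mulr0 //.
have := leq_trans (ltn_ord s) qN; move: (nat_of_ord s) => r rN; lia.
Qed.

Lemma eval_iota_Fm (u : 'rV[R]_(N * n)) (q : 'I_(n * N)) B :
  (N <= B)%N ->
  \sum_(l < B) iota (Fm u) (unindex q).1 (l%:Z - N%:Z) * t q ^+ l
  = (u *m eval_mx t) 0 q.
Proof.
move=> NB; rewrite mxE sum_mxvec_index; set j := (unindex q).1.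
rewrite (bigID (fun l : 'I_B => (l < N)%N)) /= [X in _ + X]big1 ?addr0; last first.
  move=> l; rewrite -leqNgt => Nl; rewrite iotaE.
  have -> : (l%:Z - N%:Z) = (l - N)%N by move: (nat_of_ord l) Nl => r Nl; lia.
  by rewrite mul0r.
rewrite -(big_ord_widen B (fun l => iota (Fm u) j (l%:Z - N%:Z) * t q ^+ l) NB).
rewrite (reindex_inj rev_ord_inj); apply: eq_bigr => a _ /=.
have -> : ((N - a.+1)%N%:Z - N%:Z) = Negz a.
  by move: (nat_of_ord a) (ltn_ord a) => r rN; lia.
rewrite iotaE Fm_lt (bigD1 j) //= mxE mxvec_indexK /= -/j eqxx mulr1n.
rewrite big1 ?addr0 // => j' jj'.
by rewrite mxE mxvec_indexK /= -/j (negbTE jj') mulr0n mulr0.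
Qed.

End Vanishing.

Section ShiftByZ.
Variables (R : comNzRingType) (n : nat) (N : nat).
Implicit Types (x : Vhat R n).

Fact zmul_subproof (x : laurent R) :
  exists m : int, forall i, i < m -> x (i - N%:Z) = 0.
Proof.
have [m xm] := lcoefP x; exists m => i im; apply: xm.
by rewrite ltrBlDr (lt_le_trans im) // lerDl.
Qed.

Definition zmul x : Vhat R n := [ffun j => Laurent (zmul_subproof (x j))].

Lemma zmulE x j i : zmul x j i = x j (i - N%:Z).
Proof. by rewrite ffunE. Qed.

Lemma zmul_linear : linear zmul.
Proof. by move=> a x y; apply/VhatP => j i; rewrite !(VhatD, VhatZ, zmulE). Qed.

End ShiftByZ.

Arguments zmul {R n} N x.

Section InterpolationEval.
Variables (k : fieldType) (n N : nat) (w : Vminus k n -> Vhat k n).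
Hypotheses (wL : linear w) (wE : normalized w).
Variables (R : comAlgType k) (b : nat) (t : 'I_(n * N) -> R) (g : Vminus R n).
Hypothesis tb : formal_point b t.
Hypothesis hg : act_minus (mu_inv t) g = [ffun=> 1].
Variable phi : {rmorphism mps (n * N) k -> R}.
Hypothesis phiE : forall f, phi f = mps_eval b t f.

(** The division of [w v] by [h], evaluated at [t_ij]: the multiple of [h]
    vanishes and the remainder is a polynomial, evaluated by a block Vandermonde
    matrix. *)
Lemma interp_matrix_eval (C : 'M[k]_(n * N, N * n)) :
  map_mx phi (interp_matrix (fun r => zmul N (w (Fm (row r C)))))
  = map_mx (in_alg R) C *m lin1_mx (remainder (N := N) (extend w) g (mu_inv t))
      *m eval_mx t.
Proof.
have WL := extend_linear (R := R) w.
have WE := extend_normalized (R := R) wE.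
have hN j := size_mu_inv t j.
apply/matrixP => r q; case: (mxvec_indexP q) => j i.
rewrite mxE mxE mxvecE mxE phiE.
rewrite (mps_eval_subst tb _ _ (leq_addl N b)).
pose u := map_mx (in_alg R) (row r C).
have -> : (map_mx (in_alg R) C *m lin1_mx (remainder (N := N) (extend w) g (mu_inv t))
      *m eval_mx t) r (mxvec_index j i)
    = (remainder (extend w) g (mu_inv t) u *m eval_mx t) 0 (mxvec_index j i).
  rewrite -(mul_rV_lin1_linear u (remainder_linear (N := N) g (mu_inv t) WL)).
  by rewrite -mulmxA -[in RHS]mulmxA /u map_row -row_mul [in RHS]mxE.
have tB : t (tidx i j) ^+ (N + b) = 0.
  by rewrite (formal_point_expr tb) // leq_addl.
rewrite -(eval_iota_Fm t _ _ (leq_addr b N)) mxvec_indexK /=.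
have E := eval_act_mu_inv (Vplus_regular (act g (tail (extend w) (Fm u)))) tB.
rewrite -[RHS]addr0 -[X in _ = _ + X]E -big_split /=; apply: eq_bigr => l _.
rewrite -mulrDl -VhatD -division // Fm_map extend_map // VmapE zmulE.
by rewrite mulr_algl.
Qed.

End InterpolationEval.

(** * The space [V^+ /\ z^N U] *)

Section Sections.
Variables (k : fieldType) (n N : nat) (U : set (Vhat k n)).
Variable w : Vminus k n -> Vhat k n.
Hypotheses (wF : frame U w) (wE : normalized w).
Implicit Types (u : 'rV[k]_(N * n)) (C : 'M[k]_(n * N, N * n)).

Let wL : linear w. Proof. by case: wF. Qed.

Definition section_of u : Vhat k n := zmul N (w (Fm u)).

Lemma section_of_linear : linear section_of.
Proof.
by move=> a u v; rewrite /section_of Fm_is_linear wL; apply: zmul_linear.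
Qed.

Lemma section_of_eq0 u : section_of u = 0 -> u = 0.
Proof.
move=> u0; have wu0 : w (Fm u) = 0.
  apply/VhatP => j i; have := congr1 (fun x : Vhat k n => x j (i + N%:Z)) u0.
  by rewrite zmulE addrK !Vhat0.
by rewrite -[u]principal_part_Fm -[Fm u]wE wu0 !raddf0.
Qed.

(** The frame [w] identifies [z^N U] with [z^N V^-], and [V^+] is cut out there
    by the condition that the pole of the element of [V^-] has order at most
    [N]. *)
Lemma mem_Vplus_zshift x :
  (Vplus `&` zshift N U) x <-> exists u, x = section_of u.
Proof.
have [_ _ wr _] := wF; split=> [[xV [y]]|[u ->]].
  rewrite -wr => -[v _ <-] xy; exists (principal_part N (w v)).
  rewrite /section_of Fm_principal_part ?wE; last first.
    apply/zVplus_pole => j a Na; rewrite coef_pole.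
    have := xy j (Negz a + N%:Z); rewrite addrK => <-.
    by rewrite xV //; lia.
  by apply/VhatP => j i; rewrite xy zmulE.
split; last first.
  exists (w (Fm u)); first by rewrite -wr; exists (Fm u).
  by move=> j i; rewrite zmulE.
move=> j i i0; rewrite zmulE.
have -> : i - N%:Z = Negz (N + `|i|.-1) by lia.
by rewrite -coef_pole wE Fm_ge // leq_addr.
Qed.

Lemma sum_section_of (c : 'I_(n * N) -> k) C :
  \sum_r c r *: section_of (row r C) = section_of ((\row_r c r) *m C).
Proof.
pose F : {linear 'rV[k]_(N * n) -> Vhat k n} := HB.pack section_of
  (GRing.isLinear.Build k 'rV[k]_(N * n) (Vhat k n) *:%R _ section_of_linear).
rewrite mulmx_sum_row -[section_of]/(F : _ -> _) linear_sum.
by apply: eq_bigr => r _; rewrite linearZ mxE.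
Qed.

Lemma basis_sections :
  is_basis (Vplus `&` zshift N U)
    (fun r => section_of (row r (rowsub (@pole_index n N) 1%:M))).
Proof.
split=> [r|x|c].
- by apply/mem_Vplus_zshift; exists (row r (rowsub (@pole_index n N) 1%:M)).
- move=> /mem_Vplus_zshift[u ->]; exists (fun r => u 0 (pole_index r)).
  rewrite sum_section_of /=; have -> : \row_r u 0 (pole_index r) = colsub (@pole_index n N) u.
    by apply/rowP => r; rewrite !mxE.
  by rewrite -(mulmx_reindex _ _ (@pole_index_bij n N)) mulmx1 subrr.
rewrite sum_section_of => /section_of_eq0 c0 r.
have /rowP/(_ (pole_index r)) := c0; rewrite !mxE (bigD1 r) //= big1 ?addr0.
  by rewrite !mxE eqxx mulr1.
move=> l lr; rewrite !mxE (inj_eq (bij_inj (@pole_index_bij n N))) (negbTE lr).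
by rewrite mulr0.
Qed.

Lemma basis_det_neq0 C :
  is_basis (Vplus `&` zshift N U) (fun r => section_of (row r C)) ->
  \det (colsub (@pole_index n N) C) != 0.
Proof.
move=> [_ _ Cfree]; apply/negP => /det0P[c c0 cC].
have cC0 : c *m C = 0.
  apply/rowP => p; have [s sK Ks] := @pole_index_bij n N.
  have /rowP/(_ (s p)) := cC; rewrite mulmx_colsub.
  by rewrite mxE Ks => ->; rewrite !mxE.
case/eqP: c0; apply/rowP => r; rewrite [RHS]mxE; apply: (Cfree (c 0)).
have -> : \sum_r c 0 r *: section_of (row r C) = section_of (c *m C).
  by rewrite sum_section_of; congr (section_of (_ *m _)); apply/rowP => l; rewrite mxE.
by rewrite cC0; have := section_of_linear (-1) 0 0;
  rewrite !scaleN1r !addNr.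
Qed.

End Sections.

(** The [t_ij] are nilpotent at a formal point, so the geometric series of each
    factor is finite. *)
Lemma mu_inv_invertible (k : fieldType) (R : comAlgType k) n N b
    (t : 'I_(n * N) -> R) : formal_point b t ->
  exists g : Vminus R n, act_minus (mu_inv t) g = [ffun=> 1].
Proof.
move=> tb.
exists [ffun j => \prod_(i < N) \sum_(l < b) (t (tidx i j) *: 'X) ^+ l].
apply/ffunP => j; rewrite !ffunE -big_split /= big1 // => i _.
rewrite -opprB mulNr -subrX1 opprB exprZn.
by rewrite (formal_point_expr tb) // scale0r subr0.
Qed.

Theorem lemma2p5 (k : closedFieldType) (k_char0 : [pchar k] =i pred0)
    (n : nat) (U : set (Vhat k n)) (U_Gr0 : Gr0 U)
    (Omega_U : ~ section_eq U Omega_plus (fun=> 0))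
    (delta : (Vminus k n -> Vhat k n) -> k) (delta_U : det_dual U delta)
    (delta_neq0 : ~ section_eq U delta (fun=> 0)) :
  exists N0 : nat, forall N : nat, (N0 <= N)%N ->
    [/\ exists tau : mps (n * N) k, is_pullback U delta tau,
        exists f : 'I_(n * N) -> Vhat k n, is_basis (Vplus `&` zshift N U) f
      & forall (tau : mps (n * N) k) (f : 'I_(n * N) -> Vhat k n),
          is_pullback U delta tau ->
          is_basis (Vplus `&` zshift N U) f ->
          exists2 c : k, c != 0 &
            (\prod_(j < n) Delta k N j) * tau = c *: \det (interp_matrix f)].
Proof.
have [w0 w0F w0U] : exists2 w0, frame U w0 & fdet w0 != 0.
  apply: contrapT => no_w0; apply: Omega_U => w0 w0F.
  by apply/eqP; apply: contrapT => /negP w0U; apply: no_w0; exists w0.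
have [w wF wE] := exists_normalized_frame w0F w0U.
have [wL _ _ _] := wF.
have dw0 : delta w != 0.
  apply/eqP => dw; apply: delta_neq0 => w' w'F.
  by rewrite (det_dual_normalized delta_U wF wE w'F) dw mul0r.
(* Every N is large enough: U is a complement of V^+, so the dimension of
   V^+ /\ z^N U is nN. *)
exists 0%N => N _.
have pullbackP (tau : mps (n * N) k) (R : comAlgType k) b t (g : Vminus R n) :
    act_minus (mu_inv t) g = [ffun=> 1] ->
    tau_value U delta g (mu_inv t) (mps_eval b t tau) <->
    \det (lin1_mx (remainder (N := N) (extend w) g (mu_inv t)))
      = delta w *: mps_eval b t tau.
  move=> hg; rewrite -(fdet_remainder (extend_linear w) (extend_normalized wE) hg).
    exact: tau_valueP.
  exact: size_mu_inv.
split.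
- exists ((delta w)^-1 *: \det (universal_remainder N w)) => R b t tb g hg.
  apply/pullbackP => //; have [phi phiE] := mps_eval_rmorphism tb.
  rewrite mps_evalZ scalerA divff // scale1r -phiE -det_map_mx.
  by rewrite (universal_remainder_eval tb hg phiE wL).
- by exists (fun r => section_of w (row r (rowsub (@pole_index n N) 1%:M)));
    exact: basis_sections wF wE.
move=> tau f tauU fB.
have [u fE] : exists u : 'I_(n * N) -> 'rV[k]_(N * n),
    forall r, f r = section_of w (u r).
  have [f_in _ _] := fB; have uP r := (mem_Vplus_zshift N wF wE (f r)).1 (f_in r).
  by exists (fun r => projT1 (cid (uP r))) => r; case: cid.
pose C : 'M[k]_(n * N, N * n) := \matrix_(r < n * N) u r.
have fC : f = fun r => section_of w (row r C).
  by apply/funext => r; rewrite fE rowK.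
have C0 : \det (colsub (@pole_index n N) C) != 0.
  by apply: (basis_det_neq0 wF); rewrite -fC.
(* The Vandermonde determinant is the product of the t_lj - t_ij for i < l,
   which are the opposites of the factors of Delta_j. *)
pose sgn (K : comNzRingType) : K := \prod_(j < n) \prod_(i < N)
  \prod_(l < N | (i < l)%N) (- 1).
have sgn0 : sgn k != 0.
  do 3![apply/prodf_neq0 => ? _].
  by rewrite oppr_eq0 oner_eq0.
pose c := \det (colsub (@pole_index n N) C) * sgn k * delta w.
have c0 : c != 0 by rewrite !mulf_neq0.
exists c^-1; first by rewrite invr_eq0.
suff -> : \det (interp_matrix f) = c *: (\prod_(j < n) Delta k N j * tau).
  by rewrite scalerA mulVf // scale1r.
apply: mps_eval_inj => R b t tb.
have [g hg] := mu_inv_invertible tb.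
have [phi phiE] := mps_eval_rmorphism tb.
have /pullbackP-/(_ hg) detE := tauU R b t tb g hg.
rewrite mps_evalZ -!phiE rmorphM -det_map_mx fC (interp_matrix_eval wL wE tb hg phiE).
rewrite det_interpolation detE -phiE /c -[delta w *: _]mulr_algl.
have -> : colsub (@pole_index n N) (map_mx (in_alg R) C)
    = map_mx (in_alg R) (colsub (@pole_index n N) C).
  by apply/matrixP => i j; rewrite !mxE.
rewrite det_map_mx.
have sgnR : in_alg R (sgn k) = sgn R.
  by do 3![rewrite rmorph_prod; apply: eq_bigr => ? _]; apply: rmorphN1.
have -> : \prod_(j < n) \prod_(i < N) \prod_(l < N | (i < l)%N)
    (t (tidx l j) - t (tidx i j)) = in_alg R (sgn k) * phi (\prod_(j < n) Delta k N j).
  rewrite sgnR /sgn.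
  do 3![rewrite rmorph_prod -big_split; apply: eq_bigr => ? _ /=].
  by rewrite mulN1r rmorphB !phiE !(mps_eval_var tb) opprB.
rewrite -[RHS]mulr_algl -[(_ * _)%:A]/(in_alg R _) !rmorphM /=.
ring.
Qed.
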